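(* Assume that the Markov chain $X$ is tail-trivial. Then, under $\mathbb{P}$, every event in the $\sigma$-algebra of non-local events $\mathcal{T}_{RI}$ has probability either $0$ or $1$.
   Context: Weighted graph and Markov chain. $\mathcal{G}=(\mathbb{V},\mathcal{E})$ is a simple undirected connected locally finite graph with countable vertex set; $\mathbf{a}=(a_{x,y})_{(x,y)\in\mathcal{E}}$ is a family of positive conductances with $a_{x,y}=a_{y,x}$; $a_x:=\sum_{z\sim x}a_{x,z}$. $X=(X_n)_{n\ge 0}$ is the Markov chain on $\mathbb{V}$ with transition probabilities $p_{x,y}=a_{x,y}/a_x$ if $(x,y)\in\mathcal{E}$ and $0$ otherwise; it is assumed to be transient. $P_x$ is the law of $X$ started from $x$. For $K\subset\mathbb{V}$, $\tau_K^+=\inf\{n\ge 1: X_n\in K\}$ ($\inf\emptyset=\infty$). For finite $K$, the equilibrium measure is $e_K(x)=a_xP_x[\tau_K^+=\infty]$ for $x\in K$ and $e_K(x)=0$ otherwise. Trajectories. $W^+$ (resp. $W$) is the set of nearest-neighbour trajectories in $\mathcal{G}$ indexed by $\{0,1,2,\dots\}$ (resp. by $\mathbb{Z}$) that visit each vertex only finitely many times, with the $\sigma$-algebra $\mathcal{W}^+$ (resp. $\mathcal{W}$) generated by the coordinate maps. The $P_x$ are probability measures on $(W^+,\mathcal{W}^+)$. $W_K\subset W$ is the set of trajectories that hit $K$. $W^*$ is the quotient of $W$ by time-translation ($w\sim w'$ iff $w_{n+k}=w'_n$ for all $n$, for some $k\in\mathbb{Z}$), $\pi^*:W\to W^*$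 is the projection, $\mathcal{W}^*$ is the $\sigma$-algebra inherited from $\mathcal{W}$ (quotient $\sigma$-algebra), and $W_K^*=\pi^*(W_K)$. Interlacement process. For finite $K$, $\nu_K$ is the measure on $(W,\mathcal{W})$ characterized by $\nu_K(\{w:(w_{-n})_{n\ge 0}\in A,\ w_0=x,\ (w_n)_{n\ge 0}\in B\})=P_x[A\mid\tau_K^+=\infty]\,e_K(x)\,P_x[B]$ for $x\in\mathbb{V}$, $A,B\in\mathcal{W}^+$ (read as $0$ if $e_K(x)=0$). $\nu$ is the unique measure on $(W^*,\mathcal{W}^* )$ such that for every finite $K\subset\mathbb{V}$ the restriction of $\nu$ to $W_K^*$ equals $\nu_K\circ(\pi^* )^{-1}$. $\Omega$ is the set of point measures $\omega=\sum_{i\ge 1}\delta_{w_i^*}$ on $W^*$ with $\omega(W_K^* )<\infty$ for all finite $K$, $\mathcal{A}$ is the $\sigma$-algebra on $\Omega$ generated by the maps $\omega\mapsto\omega(D)$, $D\in\mathcal{W}^*$, and $\mathbb{P}$ is the law on $(\Omega,\mathcal{A})$ of a Poisson point process with intensity measure $\nu$. Non-local events. For finite $K$ and $w\in W_K$, let $\tau_K(w)=\inf\{n\in\mathbb{Z}:w_n\in K\}$, $\lambda_K(w)=\sup\{n\in\mathbb{Z}:w_n\in K\}$, $\mathrm{Out}_{\to K}(w)=(w_{\tau_K(w)+n})_{n\le 0}$, $\mathrm{Out}_{K\to}(w)=(w_{\lambda_K(w)+n})_{n\ge 0}$, and $\mathrm{Out}_K(w)=(\mathrm{Out}_{\to K}(w),\mathrm{Out}_{K\to}(w))$.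 For $\omega=\sum_{i\ge1}\delta_{w_i^*}\in\Omega$ with arbitrary representatives $w_i$ of $w_i^*$, set $\mathrm{Out}_K(\omega)=\sum_{i: w_i^*\in W_K^*}\delta_{\mathrm{Out}_K(w_i)}+\sum_{i:w_i^*\notin W_K^*}\delta_{w_i^*}$, a random point measure (on the disjoint union of the space of pairs of semi-infinite trajectories and $W^*$; point measures carry the $\sigma$-algebra generated by evaluations on measurable sets). $\mathcal{T}_{RI}=\bigcap_{K\subset\mathbb{V}\text{ finite}}\sigma(\mathrm{Out}_K)$. Tail-triviality. Let $\theta:W^+\to W^+$, $(w_n)_{n\ge0}\mapsto(w_{n+1})_{n\ge0}$, and $\mathcal{T}_{MC}=\{A\in\mathcal{W}^+:\theta^{-1}(A)=A\}$. $X$ is tail-trivial if for some (equivalently, all) $x\in\mathbb{V}$, $P_x[A]\in\{0,1\}$ for every $A\in\mathcal{T}_{MC}$. *)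

(* Defs.v *)
From HB Require Import structures.
From mathcomp Require Import all_boot all_order all_algebra finmap.
From mathcomp Require Import all_classical all_reals all_analysis.
From mathcomp Require Import measurable_realfun.

Set Implicit Arguments.
Unset Strict Implicit.
Unset Printing Implicit Defensive.

Import Order.TTheory GRing.Theory Num.Theory.
Import numFieldNormedType.Exports.

Local Open Scope classical_set_scope.
Local Open Scope ring_scope.

(* Only the values of [conductance] on edges matter.  The field [adj_edge]
   excludes the empty graph and the one-vertex graph, for which the transition
   probabilities below do not define a Markov chain. *)
Record weighted_graph (R : realType) := WeightedGraph {
  vertex :> countType ;
  adj : rel vertex ;
  conductance : vertex -> vertex -> R ;
  adj_sym : symmetric adj ;
  adj_irr : irreflexive adj ;
  adj_connected : forall x y, exists2 s, path adj x s & last x s = y ;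
  adj_locally_finite : forall x, finite_set [set y | adj x y] ;
  adj_edge : exists x y, adj x y ;
  conductance_gt0 : forall x y, adj x y -> 0 < conductance x y ;
  conductance_sym : forall x y, adj x y -> conductance x y = conductance y x
}.

Arguments adj {R w} _ _.
Arguments conductance {R w} _ _.

Section chain.
Context {R : realType} {G : weighted_graph R}.

Definition vertex_weight (x : G) : R :=
  \sum_(z \in [set z | adj x z]) conductance x z.

Definition transition (x y : G) : R :=
  if adj x y then conductance x y / vertex_weight x else 0.

Fixpoint transition_iter (n : nat) (x y : G) : R :=
  if n is m.+1 then
    \sum_(z \in [set z | adj x z]) transition x z * transition_iter m z y
  else (x == y)%:R.

Definition green (x y : G) : \bar R :=
  (\sum_(0 <= n <oo) (transition_iter n x y)%:E)%E.

End chain.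

Definition transient {R : realType} (G : weighted_graph R) :=
  forall x y : G, (green x y < +oo)%E.

Record transient_network (R : realType) := TransientNetwork {
  network_graph :> weighted_graph R ;
  network_transient : transient network_graph
}.

Record semi_trajectory (R : realType) (G : transient_network R) :=
  SemiTrajectory {
  semi_fun :> nat -> G ;
  semi_step : forall n, adj (semi_fun n) (semi_fun n.+1) ;
  semi_visits : forall x, finite_set [set n | semi_fun n = x]
}.

Record trajectory (R : realType) (G : transient_network R) := Trajectory {
  traj_fun :> int -> G ;
  traj_step : forall n, adj (traj_fun n) (traj_fun (n + 1)) ;
  traj_visits : forall x, finite_set [set n | traj_fun n = x]
}.

(* Measurable spaces are inhabited in the library, so we first show that a
   transient network carries a trajectory: it is infinite, hence contains a
   ray. *)
Section inhabited.
Context {R : realType} (G : transient_network R).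
Implicit Types x y z : G.

Let has_neighbour x : exists y, adj x y.
Proof.
have [u [v uv]] := adj_edge G.
have [xu|xu] := eqVneq x u; first by exists v; rewrite xu.
have [[|y s] /=] := adj_connected x u; first by move=> _ /eqP; rewrite (negbTE xu).
by move=> /andP[xy _] _; exists y.
Qed.

Let vertex_weight_gt0 x : 0 < vertex_weight x.
Proof.
have [y xy] := has_neighbour x.
rewrite /vertex_weight (fsbigD1 y)//=; last first.
  exact: sub_finite_set (adj_locally_finite x).
rewrite ltr_pwDl ?conductance_gt0//; apply: fsumr_ge0 => z [/= xz _].
by rewrite ltW// conductance_gt0.
Qed.

Let transition_sum1 x : \sum_(z \in [set z | adj x z]) transition x z = 1.
Proof.
transitivity
    (\sum_(z \in [set z | adj x z]) conductance x z * (vertex_weight x)^-1).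
  by apply: eq_fsbigr => z; rewrite inE /transition /= => ->.
by rewrite -mulr_fsuml divff// gt_eqF// vertex_weight_gt0.
Qed.

Let transition_ge0 x y : 0 <= transition x y.
Proof.
rewrite /transition; case: ifPn => // xy.
by rewrite divr_ge0// ltW// conductance_gt0.
Qed.

Let transition_iter_ge0 n x y : 0 <= transition_iter n x y.
Proof.
elim: n x => [|n IHn] x /=; first by rewrite ler0n.
by apply: fsumr_ge0 => z _; rewrite mulr_ge0.
Qed.

Let transition_iter_sum1 n x : finite_set [set: G] ->
  \sum_(y \in [set: G]) transition_iter n x y = 1.
Proof.
move=> finG; elim: n x => [|n IHn] x /=.
  rewrite (fsbigD1 x)//= eqxx fsbig1 ?addr0// => y [_ /eqP].
  by rewrite eq_sym => /negbTE ->.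
rewrite exchange_fsbig//; last exact: adj_locally_finite.
rewrite -[RHS](transition_sum1 x); apply: eq_fsbigr => z _.
by rewrite -mulr_fsumr IHn mulr1.
Qed.

Let infinite_vertex : infinite_set [set: G].
Proof.
move=> finG; have [x _] := adj_edge G.
pose M := \sum_(y \in [set: G]) fine (green x y).
have bound n : n%:R <= M.
  have -> : n%:R =
      \sum_(y \in [set: G]) \sum_(i \in `I_n) transition_iter i x y.
    rewrite exchange_fsbig// -fsbig_ord.
    under eq_bigr do rewrite transition_iter_sum1//.
    by rewrite sumr_const card_ord.
  rewrite /M !fsbig_finite//; apply: ler_sum => y _.
  rewrite -fsbig_ord -(big_mkord xpredT (fun i => transition_iter i x y)).
  have ge0 i : (0 <= (transition_iter i x y)%:E)%E by rewrite lee_fin.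
  rewrite -lee_fin fineK; last first.
    by rewrite ge0_fin_numE ?network_transient// nneseries_ge0.
  by rewrite -sumEFin; apply: nneseries_lim_ge.
have M0 : 0 <= M by have := bound 0.
by have := archi_boundP M0; rewrite ltNge bound.
Qed.

Let ray_exists : exists w : nat -> G,
  (forall n, adj (w n) (w n.+1)) /\ injective w.
Proof.
have [x0 _] := adj_edge G.
pose reach n y := exists s, [/\ path adj x0 s, size s = n & last x0 s = y].
pose layer n y := reach n y /\ forall m, (m < n)%N -> ~ reach m y.
pose desc n v := [set y | exists s,
  [/\ path adj v s, last v s = y & layer (n + size s)%N y]].
pose good (p : nat * G) := layer p.1 p.2 /\ infinite_set (desc p.1 p.2).
have reachD n v s : reach n v -> path adj v s ->
    reach (n + size s)%N (last v s).
  move=> [t [pt <- <-]] ps; exists (t ++ s); split.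
  - by rewrite cat_path pt.
  - by rewrite size_cat.
  - by rewrite last_cat.
have good0 : good (0, x0).
  split; first by split=> //; exists [::].
  suff -> : desc 0 x0 = [set: G] by exact: infinite_vertex.
  apply/seteqP; split=> // y _.
  have ex : exists n, `[< reach n y >].
    have [s ps sy] := adj_connected x0 y.
    by exists (size s); apply/asboolP; exists s.
  case: (ex_minnP ex) => n /asboolP ny minn.
  have [s [ps sn sy]] := ny.
  exists s; rewrite /= add0n sn; split=> //; split=> // m mn /asboolP/minn.
  by rewrite leqNgt mn.
have goodS p : good p -> exists u, adj p.2 u /\ good (p.1.+1, u).
  case: p => n v [/= [nv vmin] infv]; apply: contrapT => /forallNP noS.
  apply: infv; pose Q := [set u | adj v u /\ layer n.+1 u].
  apply: (@sub_finite_set _ _ ([set v] `|` \bigcup_(u in Q) desc n.+1 u)).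
    move=> y [[|u s] /= [ps sy ly]]; first by left.
    right; move/andP: ps => [vu ps]; exists u; last first.
      by exists s; split=> //; rewrite addSnnS.
    split=> //; split.
      by have := @reachD n v [:: u] nv; rewrite /= vu addn1; apply.
    move=> m mn mu; apply: (ly.2 (m + size s)%N).
      by rewrite -addSnnS ltn_add2r.
    by rewrite -sy; exact: reachD.
  rewrite finite_setU; split=> //; apply: bigcup_finite.
    by apply: sub_finite_set (adj_locally_finite v) => u [].
  by move=> u [vu lu]; apply: contrapT => infu; apply: (noS u).
have goodS' p : exists u, good p -> adj p.2 u /\ good (p.1.+1, u).
  have [/goodS[u up]|nP] := pselect (good p); first by exists u.
  by exists x0.
have [f fP] := choice goodS'.
pose w n := iter n (fun p => (p.1.+1, f p)) (0%N, x0).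
have w1 n : (w n).1 = n by rewrite /w; elim: n => //= n ->.
have gw n : good (w n) by elim: n => // n /fP[].
exists (fun n => (w n).2); split=> [n|m n wmn].
  by have [] := fP _ (gw n).
have [[mr mm] _] := gw m; have [[nr nm] _] := gw n.
rewrite !w1 in mr mm nr nm; rewrite wmn in mr mm.
by case: (ltngtP m n) => // [/nm|/mm].
Qed.

Lemma semi_trajectory_inhabited : exists _ : semi_trajectory G, True.
Proof.
have [w [wadj winj]] := ray_exists.
have fw x : finite_set [set n | w n = x].
  apply: (@finite_preimage _ _ [set x] w); last exact: finite_set1.
  by move=> m n _ _ /winj.
by exists (SemiTrajectory wadj fw).
Qed.

Lemma trajectory_inhabited : exists _ : trajectory G, True.
Proof.
have [w _] := semi_trajectory_inhabited.
have wadj (n : int) : adj (w (absz n)) (w (absz (n + 1))).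
  case: n => n; first by rewrite -PoszD addn1; exact: semi_step.
  have -> : Negz n + 1 = - Posz n by rewrite NegzE -addn1 PoszD opprD addrNK.
  by rewrite abszN adj_sym; exact: semi_step.
have fw x : finite_set [set n : int | w (absz n) = x].
  apply: (@sub_finite_set _ _ (Posz @` [set n | w n = x] `|`
    (fun n => - Posz n) @` [set n | w n = x])).
    move=> n /= wn; have [n0|n0] := leP 0 n.
      by left; exists (absz n) => //; rewrite gez0_abs.
    by right; exists (absz n) => //; rewrite ltz0_abs// opprK.
  by rewrite finite_setU; split; apply: finite_image; exact: semi_visits.
by exists (@Trajectory _ _ (fun n => w (absz n)) wadj fw).
Qed.

End inhabited.

Definition semi_display : measure_display. Proof. by constructor. Qed.
Definition traj_display : measure_display. Proof. by constructor. Qed.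
Definition star_display : measure_display. Proof. by constructor. Qed.
Definition sum_display : measure_display -> measure_display -> measure_display.
Proof. by constructor. Qed.
Definition point_measure_display : measure_display -> measure_display.
Proof. by constructor. Qed.
Definition configuration_display : measure_display. Proof. by constructor. Qed.

Section trajectory_measurable.
Context {R : realType} (G : transient_network R).

HB.instance Definition _ := gen_eqMixin (semi_trajectory G).
HB.instance Definition _ := gen_choiceMixin (semi_trajectory G).
HB.instance Definition _ := isPointed.Build (semi_trajectory G)
  (projT1 (cid (semi_trajectory_inhabited G))).

HB.instance Definition _ := gen_eqMixin (trajectory G).
HB.instance Definition _ := gen_choiceMixin (trajectory G).
HB.instance Definition _ := isPointed.Build (trajectory G)
  (projT1 (cid (trajectory_inhabited G))).

(* The vertex set carries the discrete sigma-algebra. *)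
Definition semi_cylinders : set (set (semi_trajectory G)) :=
  \bigcup_n preimage_set_system setT (fun w : semi_trajectory G => w n)
              discrete_measurable.

Definition traj_cylinders : set (set (trajectory G)) :=
  \bigcup_n preimage_set_system setT (fun w : trajectory G => w n)
              discrete_measurable.

HB.instance Definition _ := @isMeasurable.Build semi_display
  (semi_trajectory G) <<s semi_cylinders >>
  (@sigma_algebra0 _ setT _) (@sigma_algebraC _ _)
  (@sigma_algebra_bigcup _ setT _).

HB.instance Definition _ := @isMeasurable.Build traj_display
  (trajectory G) <<s traj_cylinders >>
  (@sigma_algebra0 _ setT _) (@sigma_algebraC _ _)
  (@sigma_algebra_bigcup _ setT _).

End trajectory_measurable.

Section trajectory_theory.
Context {R : realType} {G : transient_network R}.
Implicit Types (w : trajectory G) (v : semi_trajectory G).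

Lemma semi_trajectory_ext v v' : v =1 v' -> v = v'.
Proof.
case: v v' => [f fs fv] [g gs gv] /= /funext fg.
by case: _ / fg in gs gv *; congr SemiTrajectory; exact: Prop_irrelevance.
Qed.

Let past_step w (k : int) n : adj (w (k - Posz n)) (w (k - Posz n.+1)).
Proof.
rewrite adj_sym -addn1 PoszD opprD addrA.
by rewrite -[X in adj _ (w X)](subrK 1); exact: traj_step.
Qed.

Let past_visits w (k : int) x : finite_set [set n | w (k - Posz n) = x].
Proof.
apply: (@finite_preimage _ _ [set m | w m = x] (fun n => k - Posz n)).
  by move=> m n _ _ /addrI /oppr_inj [].
exact: traj_visits.
Qed.

(* Trajectories indexed by the nonpositive integers are time-reversed, so that
   they live in [semi_trajectory G] too; reversal preserves the
   nearest-neighbour property as the graph is undirected. *)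
Definition past_from w (k : int) : semi_trajectory G :=
  SemiTrajectory (past_step w k) (past_visits w k).

Let future_step w (k : int) n : adj (w (k + Posz n)) (w (k + Posz n.+1)).
Proof. by rewrite -addn1 PoszD addrA; exact: traj_step. Qed.

Let future_visits w (k : int) x : finite_set [set n | w (k + Posz n) = x].
Proof.
apply: (@finite_preimage _ _ [set m | w m = x] (fun n => k + Posz n)).
  by move=> m n _ _ /addrI [].
exact: traj_visits.
Qed.

Definition future_from w (k : int) : semi_trajectory G :=
  SemiTrajectory (future_step w k) (future_visits w k).

Let theta_visits v x : finite_set [set n | v n.+1 = x].
Proof.
apply: (@finite_preimage _ _ [set m | v m = x] succn).
  by move=> m n _ _ [].
exact: semi_visits.
Qed.

Definition theta v : semi_trajectory G :=
  @SemiTrajectory _ G (fun n => v n.+1) (fun n => semi_step v n.+1)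
    (theta_visits v).

End trajectory_theory.

Section star.
Context {R : realType} (G : transient_network R).
Local Open Scope quotient_scope.

Definition translate_rel (w w' : trajectory G) : bool :=
  `[< exists k : int, forall n, w (n + k) = w' n >].

Let translate_refl : reflexive translate_rel.
Proof. by move=> w; apply/asboolP; exists 0 => n; rewrite addr0. Qed.

Let translate_impl (w w' : trajectory G) :
  translate_rel w w' -> translate_rel w' w.
Proof.
move=> /asboolP[k ww']; apply/asboolP; exists (- k) => n.
by rewrite -ww' subrK.
Qed.

Let translate_symmetric : symmetric translate_rel.
Proof. by move=> w w'; apply/idP/idP; exact: translate_impl. Qed.

Let translate_trans : transitive translate_rel.
Proof.
move=> w2 w1 w3 /asboolP[k w12] /asboolP[l w23]; apply/asboolP.
by exists (l + k) => n; rewrite addrA w12 w23.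
Qed.

Canonical translate_equiv :=
  EquivRel translate_rel translate_refl translate_symmetric translate_trans.

Definition star : Type := {eq_quot translate_equiv}.

HB.instance Definition _ := EqQuotient.on star.
HB.instance Definition _ := Choice.on star.

Definition pi_star (w : trajectory G) : star := \pi_star w.

HB.instance Definition _ := isPointed.Build star (pi_star point).

Definition star_measurable : set (set star) :=
  image_set_system setT pi_star measurable.

Let star_sigma : sigma_algebra setT star_measurable.
Proof. exact: sigma_algebra_image (sigma_algebra_measurable _). Qed.

Let star_measurable0 : star_measurable set0.
Proof. by case: star_sigma. Qed.

Let star_measurableC A : star_measurable A -> star_measurable (~` A).
Proof. by case: star_sigma => _ + _ => /[apply]; rewrite setTD. Qed.

Let star_measurable_bigcup (F : (set star)^nat) : (forall i, star_measurable (F i)) ->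
  star_measurable (\bigcup_i F i).
Proof. by case: star_sigma => _ _; apply. Qed.

HB.instance Definition _ := @isMeasurable.Build star_display star
  star_measurable star_measurable0 star_measurableC star_measurable_bigcup.

End star.

Section hitting.
Context {R : realType} {G : transient_network R}.
Implicit Types (K : {fset G}) (w : trajectory G).

Definition hitting K : set (trajectory G) := [set w | exists n, w n \in K].

Definition hitting_star K : set (star G) := @pi_star R G @` hitting K.

(* On [hitting K] the infimum and the supremum below are attained; outside of
   it [first_hit] and [last_hit] have the dummy value 0. *)
Definition first_hit K w : int :=
  xget 0 [set n | w n \in K /\ forall m, w m \in K -> n <= m].

Definition last_hit K w : int :=
  xget 0 [set n | w n \in K /\ forall m, w m \in K -> m <= n].

Definition out_traj K w : semi_trajectory G * semi_trajectory G :=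
  (past_from w (first_hit K w), future_from w (last_hit K w)).

End hitting.

Section sum_measurable.
Context d1 d2 (T1 : measurableType d1) (T2 : measurableType d2).

HB.instance Definition _ := isPointed.Build (T1 + T2)%type (inl point).

Definition sum_measurable : set (set (T1 + T2)) :=
  [set D | measurable (inl @^-1` D) /\ measurable (inr @^-1` D)].

Let sum_measurable0 : sum_measurable set0.
Proof. by split; rewrite preimage_set0. Qed.

Let sum_measurableC A : sum_measurable A -> sum_measurable (~` A).
Proof. by move=> [? ?]; split; rewrite preimage_setC; exact: measurableC. Qed.

Let sum_measurable_bigcup (F : (set (T1 + T2))^nat) : (forall i, sum_measurable (F i)) ->
  sum_measurable (\bigcup_i F i).
Proof.
by move=> mF; split; rewrite preimage_bigcup; apply: bigcupT_measurable => i;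
  have [] := mF i.
Qed.

HB.instance Definition _ := @isMeasurable.Build (sum_display d1 d2)
  (T1 + T2)%type sum_measurable
  sum_measurable0 sum_measurableC sum_measurable_bigcup.

End sum_measurable.

(* Finite or countable sums of Dirac measures, as functions on all sets. *)
Record point_measure d (T : measurableType d) (R : realType) := PointMeasure {
  point_measure_fun :> set T -> \bar R ;
  point_measureP : exists (I : set nat) (t : nat -> T), forall D,
    point_measure_fun D = \esum_(i in I) \d_(t i) D
}.

Section point_measure_measurable.
Context d (T : measurableType d) (R : realType).

HB.instance Definition _ := gen_eqMixin (point_measure T R).
HB.instance Definition _ := gen_choiceMixin (point_measure T R).

Let zero_point_measureP : exists (I : set nat) (t : nat -> T), forall D,
  0%E = \esum_(i in I) \d_(t i) D :> \bar R.
Proof. by exists set0, (fun=> point) => D; rewrite esum_set0. Qed.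

Definition zero_point_measure : point_measure T R :=
  PointMeasure zero_point_measureP.

HB.instance Definition _ :=
  isPointed.Build (point_measure T R) zero_point_measure.

Definition point_measure_evaluations : set (set (point_measure T R)) :=
  \bigcup_(D in measurable)
    preimage_set_system setT (fun mu : point_measure T R => mu D)
      (@measurable _ (\bar R)).

HB.instance Definition _ := @isMeasurable.Build (point_measure_display d)
  (point_measure T R) <<s point_measure_evaluations >>
  (@sigma_algebra0 _ setT _) (@sigma_algebraC _ _)
  (@sigma_algebra_bigcup _ setT _).

End point_measure_measurable.

Section point_measure_image.
Context d1 d2 (T1 : measurableType d1) (T2 : measurableType d2) (R : realType).
Variables (f : T1 -> T2) (mu : point_measure T1 R).

Let point_measure_imageP : exists (I : set nat) (t : nat -> T2), forall D,
  mu (f @^-1` D) = \esum_(i in I) \d_(t i) D.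
Proof.
have [I [t muE]] := point_measureP mu; exists I, (f \o t) => D.
exact: muE.
Qed.

(* The image by [f] of the sum of the [\d_(t i)] is that of the
   [\d_(f (t i))]. *)
Definition point_measure_image : point_measure T2 R :=
  PointMeasure point_measure_imageP.

End point_measure_image.

Record configuration (R : realType) (G : transient_network R) :=
  Configuration {
  configuration_measure :> point_measure (star G) R ;
  configuration_lt_pinfty : forall K : {fset G},
    (configuration_measure (hitting_star K) < +oo)%E
}.

Section configuration_measurable.
Context {R : realType} (G : transient_network R).

HB.instance Definition _ := gen_eqMixin (configuration G).
HB.instance Definition _ := gen_choiceMixin (configuration G).
HB.instance Definition _ := isPointed.Build (configuration G)
  (@Configuration R G (zero_point_measure _ R) (fun=> ltey 0)).

Definition configuration_evaluations : set (set (configuration G)) :=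
  \bigcup_(D in measurable)
    preimage_set_system setT (fun omega : configuration G => omega D)
      (@measurable _ (\bar R)).

HB.instance Definition _ := @isMeasurable.Build configuration_display
  (configuration G) <<s configuration_evaluations >>
  (@sigma_algebra0 _ setT _) (@sigma_algebraC _ _)
  (@sigma_algebra_bigcup _ setT _).

End configuration_measurable.

Notation out_space G :=
  ((semi_trajectory G * semi_trajectory G) + star G)%type (only parsing).

Section non_local.
Context {R : realType} {G : transient_network R}.
Implicit Types (K : {fset G}) (w : trajectory G) (omega : configuration G).

Definition out_star K (c : star G) : out_space G :=
  if `[< hitting_star K c >] then inl (out_traj K (repr c)) else inr c.

(* The lemma [outE] below gives the expression of [out K omega] in terms of
   arbitrary representatives of the points of [omega]. *)
Definition out K omega : point_measure (out_space G) R :=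
  point_measure_image (out_star K) omega.

Definition non_local_events : set (set (configuration G)) :=
  \bigcap_(K in [set: {fset G}]) g_sigma_algebra_preimage (out K).

Let finite_hits K w : finite_set [set n | w n \in K].
Proof.
have -> : [set n | w n \in K] = \bigcup_(x in [set` K]) [set n | w n = x].
  by apply/seteqP; split=> n /= => [wn|[x xK ->//]]; exists (w n).
by apply: bigcup_finite => // x _; exact: traj_visits.
Qed.

Let extremumP (le : rel int) : total le -> transitive le -> reflexive le ->
  forall (s : seq int) x, x \in s -> exists2 m, m \in s & forall y, y \in s -> le m y.
Proof.
move=> le_total le_trans le_refl s x; elim: s x => // a s IHs x _.
have [->|[b bs]] : s = [::] \/ exists b, b \in s.
- by case: s {IHs} => [|b s]; [left|right; exists b; rewrite mem_head].
- by exists a; rewrite ?mem_head// => y; rewrite inE => /eqP ->.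
have [m ms mmin] := IHs b bs.
have [am|ma] := orP (le_total a m).
  exists a; rewrite ?mem_head// => y; rewrite inE => /predU1P[->//|/mmin].
  exact: le_trans.
exists m; first by rewrite inE ms orbT.
by move=> y; rewrite inE => /predU1P[->//|/mmin].
Qed.

Let hits_extremumP (le : rel int) K w :
  total le -> transitive le -> reflexive le -> hitting K w ->
  exists n, w n \in K /\ forall m, w m \in K -> le n m.
Proof.
move=> le_total le_trans le_refl [n0 wn0].
have /finite_seqP[s /seteqP[sE1 sE2]] := finite_hits K w.
have [m ms mmin] := extremumP le_total le_trans le_refl (sE1 _ wn0).
by exists m; split=> [|n wn]; [exact: sE2|exact/mmin/sE1].
Qed.

Lemma first_hitP K w : hitting K w ->
  w (first_hit K w) \in K /\ forall m, w m \in K -> first_hit K w <= m.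
Proof.
move=> Kw; have [n wn] := hits_extremumP (@le_total _ int)
  (@le_trans _ int) (@lexx _ int) Kw.
by rewrite /first_hit; case: xgetP => [m _ //|/(_ n)].
Qed.

Lemma last_hitP K w : hitting K w ->
  w (last_hit K w) \in K /\ forall m, w m \in K -> m <= last_hit K w.
Proof.
have ge_total : total (fun m n : int => n <= m) by move=> m n; exact: le_total.
have ge_trans : transitive (fun m n : int => n <= m).
  by move=> m n p /[swap]; exact: le_trans.
move=> Kw; have [n wn] := hits_extremumP ge_total ge_trans (@lexx _ int) Kw.
by rewrite /last_hit; case: xgetP => [m _ //|/(_ n)].
Qed.

Let pi_starP w w' : pi_star w = pi_star w' ->
  exists k : int, forall n, w (n + k) = w' n.
Proof. by move=> /eqmodP/asboolP. Qed.

Let translate_hitting K w w' (k : int) : (forall n, w (n + k) = w' n) ->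
  hitting K w -> hitting K w'.
Proof. by move=> ww' [n wn]; exists (n - k); rewrite -ww' subrK. Qed.

Lemma hitting_starE K w : hitting_star K (pi_star w) <-> hitting K w.
Proof.
split=> [[w' Kw' /pi_starP[k]]|Kw]; last by exists w.
by move=> /translate_hitting; apply.
Qed.

Lemma out_traj_translate K w w' : hitting K w -> pi_star w = pi_star w' ->
  out_traj K w = out_traj K w'.
Proof.
move=> Kw /pi_starP[k ww']; have Kw' := translate_hitting ww' Kw.
have ww n : w n = w' (n - k) by rewrite -ww' subrK.
have [f1 f2] := first_hitP Kw; have [f1' f2'] := first_hitP Kw'.
have [l1 l2] := last_hitP Kw; have [l1' l2'] := last_hitP Kw'.
have fE : first_hit K w = first_hit K w' + k.
  apply/le_anti; rewrite f2 ?ww'//= -lerBrDr.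
  by apply: f2'; rewrite -ww.
have lE : last_hit K w = last_hit K w' + k.
  apply/le_anti; rewrite l2 ?ww'// andbT -lerBlDr.
  by apply: l2'; rewrite -ww.
congr pair; apply: semi_trajectory_ext => n /=.
  by rewrite fE -ww' addrAC.
by rewrite lE -ww' addrAC.
Qed.

Lemma outE K omega (I : set nat) (w : nat -> trajectory G) :
  (forall D, omega D = \esum_(i in I) \d_(pi_star (w i)) D) ->
  forall D, out K omega D =
    (\esum_(i in I `&` [set i | hitting K (w i)])
       \d_(inl (out_traj K (w i)) : out_space G) D +
     \esum_(i in I `&` ~` [set i | hitting K (w i)])
       \d_(inr (pi_star (w i)) : out_space G) D)%E.
Proof.
move=> omegaE D; rewrite /= omegaE (esumID [set i | hitting K (w i)]); last first.
  by move=> i _; exact: measure_ge0.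
have dE i z : out_star K (pi_star (w i)) = z ->
    \d_(pi_star (w i)) (out_star K @^-1` D) = \d_z D :> \bar R.
  by move=> <-.
congr (_ + _)%E; apply: eq_esum => i [_ Kwi]; apply: dE; rewrite /out_star.
  rewrite asboolT; last exact/hitting_starE.
  congr inl; apply: out_traj_translate; last by rewrite /pi_star reprK.
  by apply/hitting_starE; rewrite /pi_star reprK; exact/hitting_starE.
by rewrite asboolF// => /hitting_starE.
Qed.

End non_local.

Section laws.
Context {R : realType} {G : transient_network R}.
Implicit Types (P : G -> probability (semi_trajectory G) R) (K : {fset G}).

Definition markov_chain_law P : Prop :=
  forall (x : G) (n : nat) (u : nat -> G),
    P x [set w | forall i, (i <= n)%N -> w i = u i] =
    ((u 0%N == x)%:R * \prod_(i < n) transition (u i) (u i.+1))%:E.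

Definition no_return K : set (semi_trajectory G) :=
  [set w | forall n, (0 < n)%N -> w n \notin K].

Definition equilibrium P K (x : G) : \bar R :=
  if x \in K then ((vertex_weight x)%:E * P x (no_return K))%E else 0%E.

(* Conditioning on an event of probability 0 gives 0 by the convention on
   [0^-1]. *)
Definition conditional_no_return P K (x : G) (A : set (semi_trajectory G)) : R :=
  fine (P x (A `&` no_return K)) / fine (P x (no_return K)).

Definition two_sided_law P K (m : {measure set (trajectory G) -> \bar R}) :
    Prop :=
  forall (x : G) (A B : set (semi_trajectory G)),
    measurable A -> measurable B ->
    m [set w | [/\ A (past_from w 0), w 0 = x & B (future_from w 0)]] =
    ((conditional_no_return P K x A)%:E * equilibrium P K x * P x B)%E.

Definition interlacement_intensity
    (nuK : {fset G} -> {measure set (trajectory G) -> \bar R})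
    (nu : {measure set (star G) -> \bar R}) : Prop :=
  forall K (D : set (star G)), measurable D ->
    nu (D `&` hitting_star K) = nuK K (@pi_star R G @^-1` D).

(* The first clause spells out the Poisson distribution: the library's
   [poisson_pmf] is not the probability mass function when the rate is 0. *)
Definition poisson_point_process (nu : {measure set (star G) -> \bar R})
    (Q : probability (configuration G) R) : Prop :=
  [/\ forall (D : set (star G)) (k : nat), measurable D -> (nu D < +oo)%E ->
        Q [set omega | omega D = k%:R%:E] =
        (fine (nu D) ^+ k / k`!%:R * expR (- fine (nu D)))%:E,
      forall D : set (star G), measurable D -> nu D = +oo%E ->
        Q [set omega | omega D = +oo%E] = 1%E
    & forall (n : nat) (D : 'I_n -> set (star G)) (B : 'I_n -> set (\bar R)),
        (forall i, measurable (D i)) -> trivIset setT D ->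
        (forall i, measurable (B i)) ->
        Q [set omega | forall i, B i (omega (D i))] =
        (\prod_(i < n) Q [set omega | B i (omega (D i))])%E].

Definition invariant_event (A : set (semi_trajectory G)) : Prop :=
  measurable A /\ @theta R G @^-1` A = A.

Definition tail_trivial P : Prop :=
  exists x : G, forall A, invariant_event A -> P x A = 0%E \/ P x A = 1%E.

End laws.

(* Main.v *)
(** Let [A] be a non-local event.  For a fixed configuration [om], whether
    [om + \d_c] belongs to [A] depends on the trajectory [c] only through its
    two ends: by tail-triviality this holds either for [nu]-almost no [c] or for
    [nu]-almost all [c].  Let [F] be the event that the second alternative holds.
    Mecke's equation then gives
    [E[om D; A, H] = nu D * Q (F `&` H)] whenever [H] is not affected by adding
    points in [D].  Since [om D] has mean [nu D] and standard deviation
    [sqrt (nu D)], the probabilities of [A `&` H] and [F `&` H] differ by at most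
    [1 / sqrt (nu D)].  The measure [nu] is infinite, because the capacities of
    finite sets are unbounded on a transient network; hence [F = A] almost surely.
    So [Q] restricted to [A] satisfies the Mecke equation of [Q], which
    determines the law of the numbers of points in disjoint sets: [A] is
    independent of every event, in particular of itself. *)

Require Import Defs.
From HB Require Import structures.
From mathcomp Require Import all_boot all_order all_algebra finmap.
From mathcomp Require Import all_classical all_reals all_analysis.
From mathcomp Require Import measurable_realfun.
From mathcomp Require Import ring lra zify.

Set Implicit Arguments.
Unset Strict Implicit.
Unset Printing Implicit Defensive.

Import Order.TTheory GRing.Theory Num.Theory.
Import numFieldNormedType.Exports.

Local Open Scope classical_set_scope.
Local Open Scope ring_scope.

(** The fact behind [F = A] is a change of measure. Adding to a configuration an independent point,
    distributed as [nu] restricted to [D] and normalised, yields the law of density [om D / nu D]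
    with respect to [Q]. This density tends to 1 in mean as [nu D] grows, so one more typical
    trajectory cannot be noticed. The events [H] to be tested are cylinders on trajectories that
    meet a finite set [K1]; hence [D] has to consist of trajectories avoiding [K1]. These still have
    unbounded mass, because those meeting [K1] have finite mass.

    The alternative for a single trajectory comes from Fubini's theorem. Under [nuK K], given the
    vertex at time 0, the past and the future have a joint law absolutely continuous with respect to
    two independent chains, and a property of the two ends is invariant under the shift of each of
    them. *)

Lemma measurable_preimage d1 d2 (T1 : measurableType d1) (T2 : measurableType d2)
    (f : T1 -> T2) (A : set T2) :
  measurable_fun setT f -> measurable A -> measurable (f @^-1` A).
Proof. by move=> mf mA; rewrite -[X in measurable X]setTI; exact: mf. Qed.

Lemma measurable_fun_preimage d1 d2 (T1 : measurableType d1)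
    (T2 : measurableType d2) (f : T1 -> T2) :
  (forall A, measurable A -> measurable (f @^-1` A)) -> measurable_fun setT f.
Proof. by move=> mf _ A mA; rewrite setTI; exact: mf. Qed.

Lemma measurable_countable_cases d (T : measurableType d) (U : countType)
    (f : T -> U) (A : U -> set T) :
  (forall u, measurable (f @^-1` [set u])) -> (forall u, measurable (A u)) ->
  measurable [set t | A (f t) t].
Proof.
move=> mf mA.
rewrite (_ : [set _ | _] = \bigcup_u (f @^-1` [set u] `&` A u)).
  by apply: countable_bigcupT_measurable => [|u];
    [exact: countableP|exact: measurableI].
by apply/seteqP; split=> t /= => [Aft|[u _ [<-]]//]; exists (f t).
Qed.

(* The library's [pushforward] becomes a measure only once the measurability of
   the map is supplied. *)
Definition image_measure d1 d2 (T1 : measurableType d1) (T2 : measurableType d2)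
  (R : realType) (m : {measure set T1 -> \bar R}) (f : T1 -> T2)
  (mf : measurable_fun setT f) : {measure set T2 -> \bar R}.
Proof. by refine (pushforward m f : {measure set T2 -> \bar R}). Defined.

Lemma image_measureE d1 d2 (T1 : measurableType d1) (T2 : measurableType d2)
    (R : realType) (m : {measure set T1 -> \bar R}) (f : T1 -> T2)
    (mf : measurable_fun setT f) A : image_measure m mf A = m (f @^-1` A).
Proof. by []. Qed.

(** * Measures on semi-infinite trajectories *)

Section semi_trajectory_measurable.
Context {R : realType} {G : transient_network R}.

Lemma measurable_semi_coord n (S : set G) :
  measurable [set w : semi_trajectory G | S (w n)].
Proof.
by apply: sub_sigma_algebra; exists n => //; exists S => //; rewrite setTI.
Qed.

Lemma measurable_traj_coord n (S : set G) :
  measurable [set w : trajectory G | S (w n)].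
Proof.
by apply: sub_sigma_algebra; exists n => //; exists S => //; rewrite setTI.
Qed.

Lemma measurable_fun_semi d (T : measurableType d) (f : T -> semi_trajectory G) :
  (forall n (S : set G), measurable [set t | S (f t n)]) ->
  measurable_fun setT f.
Proof.
move=> mf; apply: (measurability (@semi_cylinders R G)) => //.
by move=> _ [_ [n _ [S _ <-]] <-]; rewrite !setTI; exact: mf.
Qed.

Lemma measurable_theta : measurable_fun setT (@theta R G).
Proof. by apply: measurable_fun_semi => n S; exact: measurable_semi_coord. Qed.

Lemma measurable_past_from k : measurable_fun setT (@past_from R G ^~ k).
Proof. by apply: measurable_fun_semi => n S; exact: measurable_traj_coord. Qed.

Lemma measurable_future_from k : measurable_fun setT (@future_from R G ^~ k).
Proof. by apply: measurable_fun_semi => n S; exact: measurable_traj_coord. Qed.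

Definition prefix_cylinder n (u : nat -> G) : set (semi_trajectory G) :=
  [set w | forall i, (i <= n)%N -> w i = u i].

Lemma measurable_prefix_cylinder n u : measurable (prefix_cylinder n u).
Proof.
rewrite (_ : prefix_cylinder n u =
    \bigcap_(i in `I_n.+1) [set w | [set u i] (w i)]).
  by apply: bigcap_measurableType => i _; exact: measurable_semi_coord.
by apply/seteqP; split=> w wu i; exact: wu.
Qed.

Let prefix_cylinderI m n u v : (m <= n)%N ->
  prefix_cylinder m u `&` prefix_cylinder n v = prefix_cylinder n v \/
  prefix_cylinder m u `&` prefix_cylinder n v = set0.
Proof.
move=> mn; have [uv|nuv] := pselect (forall i, (i <= m)%N -> u i = v i).
  left; rewrite setIidr// => w wv i im.
  by rewrite uv// wv// (leq_trans im).
right; rewrite -subset0 => w [wu wv]; apply: nuv => i im.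
by rewrite -wu// wv// (leq_trans im).
Qed.


(** Two prefix cylinders are nested or disjoint, so together with [set0] they form a pi-system; the
    cylinders of length one give a countable cover by sets of finite mass. *)
Lemma semi_measure_unique (m1 m2 : {measure set (semi_trajectory G) -> \bar R}) :
  (forall n u, m1 (prefix_cylinder n u) = m2 (prefix_cylinder n u)) ->
  (forall x : G, (m1 [set w : semi_trajectory G | w 0%N = x] < +oo)%E) ->
  forall A, measurable A -> m1 A = m2 A.
Proof.
move=> m12 m1oo.
pose C : set (set (semi_trajectory G)) :=
  set0 |` [set A | exists n u, A = prefix_cylinder n u].
have start x : prefix_cylinder 0 (fun=> x) =
      [set w : semi_trajectory G | w 0%N = x].
  apply/seteqP; split=> [w wx|w /= wx i]; first exact: wx.
  by rewrite leqn0 => /eqP ->.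
pose x0 : G := (point : semi_trajectory G) 0%N.
pose g k := if choice.unpickle k is Some x then prefix_cylinder 0 (fun=> x) else set0.
apply: (measure_unique C g) => //.
- apply/seteqP; split.
    apply: smallest_sub; first exact: smallest_sigma_algebra.
    move=> _ [n _ [S _ <-]]; rewrite setTI.
    (* As the vertex set is countable, an event on the coordinate [n] is a countable union of prefix
       cylinders, indexed by finite sequences. *)
    rewrite (_ : _ @^-1` S = \bigcup_(s : seq G) if `[< S (nth x0 s n) >]
        then prefix_cylinder n (nth x0 s) else set0); last first.
      apply/seteqP; split=> [w Sw|w [s _]].
        exists (mkseq w n.+1) => //.
        rewrite nth_mkseq//; case: asboolP => // _ i ni.
        by rewrite nth_mkseq.
      by case: asboolP => // Ss ws; rewrite /= ws.
    apply: (@countable_bigcupT_measurable _ (g_sigma_algebraType C)).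
      exact: countableP.
    move=> s; case: ifPn => _; apply: sub_sigma_algebra; last by left.
    by right; do 2 eexists.
  apply: smallest_sub; first exact: smallest_sigma_algebra.
  by move=> A [->|[n [u ->]]]; [exact: measurable0|
    exact: measurable_prefix_cylinder].
- move=> A B [->|[n [u ->]]]; first by left; rewrite set0I.
  move=> [->|[m [v ->]]]; first by left; rewrite setI0.
  have [nm|/ltnW mn] := leqP n m.
    by have [->|->] := prefix_cylinderI u v nm; [right; do 2 eexists|left].
  rewrite setIC.
  by have [->|->] := prefix_cylinderI v u mn; [right; do 2 eexists|left].
- move=> k; rewrite /g; case: choice.unpickle => [x|]; last by left.
  by right; do 2 eexists.
- apply/seteqP; split=> // w _; exists (choice.pickle (w 0%N)) => //.
  by rewrite /g choice.pickleK start.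
- by move=> A [->|[n [u ->]]]; [rewrite !measure0|exact: m12].
- move=> k; rewrite /g; case: choice.unpickle => [x|]; last by rewrite measure0.
  by rewrite start.
Qed.

End semi_trajectory_measurable.

(** * Markov property and triviality of invariant events *)

Section chain.
Context {R : realType} {G : transient_network R}.
Variable P : G -> probability (semi_trajectory G) R.
Hypothesis P_law : markov_chain_law P.
Implicit Types (x y z : G) (E : set (semi_trajectory G)).

Lemma vertex_weight_gt0 x : 0 < vertex_weight x.
Proof.
have [y xy] : exists y, adj x y.
  have [u [v uv]] := adj_edge G.
  have [xu|xu] := eqVneq x u; first by exists v; rewrite xu.
  have [[|y s] /=] := adj_connected x u.
    by move=> _ /eqP; rewrite (negbTE xu).
  by move=> /andP[xy _] _; exists y.
rewrite /vertex_weight (fsbigD1 y)//=; last first.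
  exact: sub_finite_set (adj_locally_finite x).
rewrite ltr_pwDl ?conductance_gt0//; apply: fsumr_ge0 => z [/= xz _].
by rewrite ltW// conductance_gt0.
Qed.

Lemma transition_ge0 x y : 0 <= transition x y.
Proof.
rewrite /transition; case: ifPn => // xy.
by rewrite divr_ge0// ltW// ?conductance_gt0// vertex_weight_gt0.
Qed.

Lemma transition_iter_ge0 n x y : 0 <= transition_iter n x y.
Proof.
elim: n x => [|n IHn] x /=; first by rewrite ler0n.
by apply: fsumr_ge0 => z _; rewrite mulr_ge0// transition_ge0.
Qed.

Lemma probability_setIr d (T : measurableType d) (m : probability T R) A B :
  measurable A -> measurable B -> m B = 1%E -> m (A `&` B) = m A.
Proof.
move=> mA mB mB1; rewrite (measureDI _ mA mB) [X in (X + _)%E](_ : _ = 0%E) ?add0e//.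
have mC0 : m (~` B) = 0%E by rewrite probability_setC// mB1 subee.
exact: (subset_measure0 (measurableD mA mB) (measurableC mB)).
Qed.

Lemma start_measure x : P x [set w : semi_trajectory G | w 0%N = x] = 1%E.
Proof.
have -> : [set w : semi_trajectory G | w 0%N = x] = prefix_cylinder 0 (fun=> x).
  apply/seteqP; split=> [w /= wx i|w wx]; last exact: wx.
  by rewrite leqn0 => /eqP ->.
by rewrite P_law eqxx big_ord0 mulr1.
Qed.

(** Both sides are measures in [E], so prefix cylinders suffice: a prefix that does not start at [z]
    gives 0 twice, and one that does is lengthened by putting [x] in front. *)
Lemma markov_step_to x z E : measurable E ->
  P x ([set w : semi_trajectory G | w 0%N = x /\ w 1%N = z] `&` @theta R G @^-1` E) =
  ((transition x z)%:E * P z E)%E.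
Proof.
pose A := [set w : semi_trajectory G | w 0%N = x /\ w 1%N = z].
have mA : measurable A.
  by apply: measurableI;
    [exact: (measurable_semi_coord 0 [set x])
    |exact: (measurable_semi_coord 1 [set z])].
pose m1 : {measure set (semi_trajectory G) -> \bar R} :=
  image_measure (mrestr (P x) mA) measurable_theta.
pose m2 : {measure set (semi_trajectory G) -> \bar R} :=
  mscale (NngNum (transition_ge0 x z)) (P z).
move=> mE; transitivity (m1 E).
  by rewrite /m1 image_measureE /= /mrestr setIC.
apply: (@semi_measure_unique R G m1 m2) mE => [n u|y]; last first.
  rewrite /m1 image_measureE /= /mrestr.
  apply: (le_lt_trans (probability_le1 _ _)); rewrite ?ltry//.
  apply: measurableI => //; apply: measurable_preimage.
    exact: measurable_theta.
  exact: (measurable_semi_coord 0 [set y]).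
rewrite /m1 image_measureE /= /mrestr /m2/= /mscale/=.
have -> : P z (prefix_cylinder n u) =
    ((u 0%N == z)%:R * \prod_(i < n) transition (u i) (u i.+1))%:E.
  exact: P_law.
have [uz|uz] := eqVneq (u 0%N) z; last first.
  rewrite mul0r mule0 -[RHS](measure0 (P x)); congr (P x _).
  rewrite -subset0 => w [/= wu [_ wz]].
  by have := wu 0%N isT; rewrite /= wz => uz'; rewrite uz' eqxx in uz.
pose v i := if i is j.+1 then u j else x.
transitivity (P x (prefix_cylinder n.+1 v)).
  congr (P x _); apply/seteqP; split=> [w [/= wu [w0 w1]] [//|i]|w wv].
    exact: wu.
  split; first by move=> i ni; exact: (wv i.+1).
  by split; [exact: (wv 0%N isT)|rewrite -uz; exact: (wv 1%N isT)].
by rewrite P_law eqxx !mul1r big_ord_recl /= uz EFinM.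
Qed.

Lemma markov_step x E : measurable E ->
  P x (@theta R G @^-1` E) =
  (\sum_(z \in [set z | adj x z]) (transition x z)%:E * P z E)%E.
Proof.
move=> mE; have mtE := measurable_preimage measurable_theta mE.
rewrite -(probability_setIr mtE _ (start_measure x)); last first.
  exact: (measurable_semi_coord 0 [set x]).
rewrite (_ : _ `&` _ = \bigcup_(z in [set z | adj x z])
    ([set w : semi_trajectory G | w 0%N = x /\ w 1%N = z] `&` @theta R G @^-1` E)); last first.
  apply/seteqP; split=> [w [Ew wx]|w [z _ [[wx wz] Ew]]]; last by [].
  by exists (w 1%N) => //=; rewrite -wx; exact: semi_step.
rewrite measure_fin_bigcup//.
- by apply: eq_fsbigr => z _; exact: markov_step_to.
- exact: adj_locally_finite.
- by apply/trivIsetP => y z _ _ yz; rewrite -subset0 => w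
    [[[_ wy] _] [[_ wz] _]]; move: yz; rewrite -wy wz eqxx.
- move=> z _; apply: measurableI => //; apply: measurableI.
    exact: (measurable_semi_coord 0 [set x]).
  exact: (measurable_semi_coord 1 [set z]).
Qed.

Lemma iter_thetaE n (w : semi_trajectory G) i : iter n theta w i = w (n + i)%N.
Proof. by elim: n w i => // n IHn w i; rewrite iterSr IHn. Qed.

Lemma measurable_iter_theta n : measurable_fun setT (iter n (@theta R G)).
Proof.
apply: measurable_fun_semi => i S.
under eq_set do rewrite iter_thetaE.
exact: measurable_semi_coord.
Qed.

Lemma markov_iter n x y E : measurable E ->
  P x ([set w : semi_trajectory G | w n = y] `&` iter n theta @^-1` E) =
  ((transition_iter n x y)%:E * P y E)%E.
Proof.
move=> mE; elim: n x => [|n IHn] x.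
  rewrite -(probability_setIr _ _ (start_measure x)); last 2 first.
  - by apply: measurableI => //; exact: (measurable_semi_coord 0 [set y]).
  - exact: (measurable_semi_coord 0 [set x]).
  have [<-|xy] := eqVneq x y.
    rewrite [transition_iter _ _ _]/= eqxx mul1e setIAC setIid setIC probability_setIr//.
      exact: (measurable_semi_coord 0 [set x]).
    exact: start_measure.
  rewrite [transition_iter _ _ _]/= (negbTE xy) mul0e -[RHS](measure0 (P x)); congr (P x _).
  by rewrite -subset0 => w [[/= wy _] wx]; move: xy; rewrite -wx -wy eqxx.
rewrite (_ : _ `&` _ = @theta R G @^-1`
    ([set w : semi_trajectory G | w n = y] `&` iter n theta @^-1` E)); last first.
  by apply/seteqP; split=> w /=; rewrite -iterSr.
rewrite markov_step; last first.
  apply: measurableI; first exact: (measurable_semi_coord n [set y]).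
  exact: measurable_preimage (measurable_iter_theta n) mE.
under eq_fsbigr do rewrite IHn muleA -EFinM.
rewrite -ge0_mule_fsuml; last first.
  by move=> z; rewrite lee_fin mulr_ge0 ?transition_ge0 ?transition_iter_ge0.
congr (_ * _)%E => /=; rewrite -fsumEFin//.
exact: adj_locally_finite.
Qed.

(** For an invariant event, [P x A] is the average of [P z A] over the neighbours [z] with positive
    weights. Hence nullity passes to neighbours and, by connectedness, to every vertex; the case of
    probability 1 follows by complement. *)
Lemma invariant_event_trivial : tail_trivial P ->
  forall A, invariant_event A ->
  (forall x, P x A = 0%E) \/ (forall x, P x A = 1%E).
Proof.
have null0 A : invariant_event A -> forall x y, P x A = 0%E -> P y A = 0%E.
  move=> [mA tA] x y; have [s] := adj_connected x y.
  elim: s x => [|z s IHs] x /=; first by move=> _ ->.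
  move=> /andP[xz ps] sy PxA; apply: IHs ps sy _.
  have := markov_step x mA; rewrite tA PxA => /esym /pfsume_eq0 xA.
  have {xA} : ((transition x z)%:E * P z A = 0)%E.
    apply: xA => //; first exact: adj_locally_finite.
    by move=> v _; rewrite mule_ge0 ?lee_fin ?transition_ge0.
  move=> /eqP; rewrite mule_eq0 eqe => /orP[|/eqP//].
  rewrite /transition xz mulf_eq0 gt_eqF ?conductance_gt0//= invr_eq0.
  by rewrite gt_eqF// vertex_weight_gt0.
move=> [x Px] A iA; have [PA|PA] := Px A iA.
  by left=> y; exact: null0 PA.
right=> y; have [mA tA] := iA.
have iC : invariant_event (~` A).
  by split; [exact: measurableC|rewrite -[in RHS]tA].
rewrite -(setCK A) probability_setC; last exact: measurableC.
rewrite (null0 _ iC x y) ?sube0//.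
by rewrite probability_setC// PA subee.
Qed.

End chain.

(** * Unboundedness of the capacity *)

Section capacity.
Context {R : realType} {G : transient_network R}.
Variable P : G -> probability (semi_trajectory G) R.
Hypothesis P_law : markov_chain_law P.
Implicit Types (x y z : G) (K : {fset G}).

Lemma vertex_weight_transition x y :
  vertex_weight x * transition x y = vertex_weight y * transition y x.
Proof.
rewrite /transition adj_sym; case: ifPn => yx; last by rewrite !mulr0.
have xy : adj x y by rewrite adj_sym.
rewrite [LHS]mulrCA divff ?gt_eqF ?vertex_weight_gt0// mulr1.
rewrite [RHS]mulrCA divff ?gt_eqF ?vertex_weight_gt0// mulr1.
exact: conductance_sym.
Qed.

(** [transition_iter] peels off the first step; reversibility exchanges it with the last one, hence
    this second recursion. *)
Lemma transition_iterSr n x y : transition_iter n.+1 x y =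
  \sum_(z \in [set z | adj y z]) transition_iter n x z * transition z y.
Proof.
elim: n x => [|n IHn] x.
  have nbr (u v : G) (F : G -> R) : \sum_(z \in [set z | adj u z]) F z * (z == v)%:R =
      if adj u v then F v else 0.
    case: ifPn => [uv|/negP nuv].
      rewrite (fsbigD1 v)//=; last exact: sub_finite_set (adj_locally_finite u).
      rewrite eqxx mulr1 fsbig1 ?addr0// => z [_ /eqP] /negbTE ->.
      by rewrite mulr0.
    apply: fsbig1 => z /= uz; have [zv|] := eqVneq z v; last by rewrite mulr0.
    by rewrite zv in uz.
  rewrite [LHS]nbr; under eq_fsbigr do rewrite /= mulrC eq_sym.
  by rewrite nbr adj_sym /transition; case: ifP; rewrite // adj_sym => ->.
transitivity (\sum_(z \in [set z | adj x z])
    transition x z * transition_iter n.+1 z y); first by [].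
under eq_fsbigr do rewrite IHn mulr_fsumr.
rewrite exchange_fsbig; [|exact: adj_locally_finite|exact: adj_locally_finite].
apply: eq_fsbigr => v _; rewrite mulr_fsuml.
by apply: eq_fsbigr => z _; rewrite mulrA.
Qed.

Lemma transition_iter_reversible n x y :
  vertex_weight x * transition_iter n x y =
  vertex_weight y * transition_iter n y x.
Proof.
elim: n x y => [|n IHn] x y.
  by have [->//|xy] := eqVneq x y; rewrite /= (negbTE xy) eq_sym (negbTE xy) !mulr0.
rewrite [in RHS]transition_iterSr /= !mulr_fsumr.
apply: eq_fsbigr => z _.
by rewrite mulrA vertex_weight_transition mulrAC IHn mulrA.
Qed.

(** The expected number of visits to [y] at times at least [M]. At [M = 0] it is [green], and by
    transience it tends to 0 as [M] grows. *)
Definition green_tail M x y : \bar R :=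
  (\sum_(M <= n <oo) (transition_iter n x y)%:E)%E.

Lemma green_tailS M x y : green_tail M.+1 x y =
  (\sum_(z \in [set z | adj x z]) (transition x z)%:E * green_tail M z y)%E.
Proof.
have p0 k z u : (0 <= (transition_iter k z u)%:E :> \bar R)%E.
  by rewrite lee_fin transition_iter_ge0.
rewrite /green_tail fsbig_finite; last exact: adj_locally_finite.
under [RHS]eq_bigr do rewrite -nneseriesZl//.
rewrite -nneseries_sum; last first.
  by move=> z k _; rewrite mule_ge0// lee_fin transition_ge0.
transitivity (\sum_(M <= n <oo) (transition_iter n.+1 x y)%:E)%E.
  rewrite -nneseries_addn// -(@nneseries_addn _ (fun n => (transition_iter n.+1 x y)%:E) M)//.
  by apply: eq_eseriesr => n _; rewrite addnS.
apply: eq_eseriesr => n _ /=.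
rewrite -fsumEFin; last exact: adj_locally_finite.
by rewrite fsbig_finite; last exact: adj_locally_finite.
Qed.

Lemma green_reversible x y :
  ((vertex_weight x)%:E * green x y = (vertex_weight y)%:E * green y x)%E.
Proof.
rewrite /green -!nneseriesZl; try by move=> n _; rewrite lee_fin transition_iter_ge0.
by apply: eq_eseriesr => n _; rewrite -!EFinM transition_iter_reversible.
Qed.

Definition visits_from M (S : set G) : set (semi_trajectory G) :=
  [set w | exists2 j, (M <= j)%N & S (w j)].

Lemma measurable_visits_from M S : measurable (visits_from M S).
Proof.
rewrite (_ : visits_from M S =
    \bigcup_(j in [set j | (M <= j)%N]) [set w : semi_trajectory G | S (w j)]).
  by apply: bigcup_measurable => j _; exact: measurable_semi_coord.
by apply/seteqP; split=> w [j Mj Sj]; exists j.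
Qed.

(* Maximal inequality: the tails of the Green function are superharmonic. *)
Lemma visits_from_le (e : R) (S : set G) o : 0 < e ->
  (forall y, S y -> (e%:E <= green y o)%E) ->
  forall M x, (e%:E * P x (visits_from M S) <= green_tail M x o)%E.
Proof.
move=> e0 Se M; have t0 N z : (0 <= green_tail N z o)%E.
  by apply: nneseries_ge0 => n _ _; rewrite lee_fin transition_iter_ge0.
(* Averaging a bound by the tail from [N] over the first step gives a bound by the tail from
   [N.+1]. *)
have stepb (B : G -> set (semi_trajectory G)) N x :
    (forall z, measurable (B z)) ->
    (forall z, e%:E * P z (B z) <= green_tail N z o)%E -> 
    (forall z z', B z = B z') ->
    (e%:E * P x (@theta R G @^-1` B x) <= green_tail N.+1 x o)%E.
  move=> mB Bz BB; rewrite (markov_step P_law)// ge0_mule_fsumr; last first.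
    by move=> z; rewrite mule_ge0// lee_fin transition_ge0.
  rewrite green_tailS; apply: lee_fsum; first exact: adj_locally_finite.
  move=> z _; rewrite muleCA; apply: lee_wpmul2l.
    by rewrite lee_fin transition_ge0.
  by rewrite (BB x z).
elim: M => [|M IHM] x; last first.
  rewrite (_ : visits_from M.+1 S = @theta R G @^-1` visits_from M S).
    apply: (stepb (fun=> visits_from M S)) => // _.
    exact: measurable_visits_from.
  apply/seteqP; split=> w; last by move=> [j Mj Sj]; exists j.+1.
  by move=> [[//|j] Mj Sj]; exists j.
(* For [M = 0] the induction is on a time horizon: [B m] asks for a visit to [S] before time [m],
   and the limit in [m] is taken at the end. *)
pose B m := [set w : semi_trajectory G | exists2 j, (j < m)%N & S (w j)].
have mB m : measurable (B m).
  rewrite (_ : B m =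
      \bigcup_(j in `I_m) [set w : semi_trajectory G | S (w j)]).
    by apply: bigcup_measurable => j _; exact: measurable_semi_coord.
  by apply/seteqP; split=> w [j jm Sj]; exists j.
have BE : visits_from 0 S = \bigcup_m B m.
  apply/seteqP; split=> w [j _ Sj]; first by exists j.+1 => //; exists j.
  by case: Sj => i _ Si; exists i.
have PB : P x (B m) @[m --> \oo] --> P x (visits_from 0 S).
  rewrite BE; apply: nondecreasing_cvg_mu => //; first exact: bigcupT_measurable.
  move=> m n mn; apply/subsetPset => w [j jm Sj]; exists j => //.
  exact: leq_trans mn.
suff bound m z : (e%:E * P z (B m) <= green_tail 0 z o)%E.
  have PB' : (e%:E * P x (B m) @[m --> \oo] --> e%:E * P x (visits_from 0 S))%E.
    exact: cvgeZl.
  rewrite -(cvg_lim _ PB')//; apply: lime_le; first by apply/cvg_ex; eexists; exact: PB'.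
  exact: nearW.
elim: m z => [|m IHm] z.
  rewrite (_ : B 0%N = set0) ?measure0 ?mule0//.
  by rewrite -subset0 => w [].
have [Sz|nSz] := pselect (S z).
  apply: le_trans (Se _ Sz); rewrite -[leRHS]mule1; apply: lee_wpmul2l.
    by rewrite lee_fin ltW.
  exact: probability_le1.
(* From a vertex outside [S], a visit before time [m.+1] is, after one step, a visit before time
   [m]; and the tail from 1 is at most the tail from 0. *)
apply: (@le_trans _ _ (green_tail 1 z o)); last first.
  rewrite /green_tail (@nneseries_split _ _ 0 1) => [|n _]; last first.
    by rewrite lee_fin transition_iter_ge0.
  by rewrite big_nat1 leeDr// lee_fin transition_iter_ge0.
apply: (@le_trans _ _ (e%:E * P z (@theta R G @^-1` B m))%E); last first.
  exact: (stepb (fun=> B m)).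
apply: lee_wpmul2l; first by rewrite lee_fin ltW.
rewrite -(probability_setIr (mB m.+1) _ (start_measure P_law z)); last first.
  exact: (measurable_semi_coord 0 [set z]).
apply: le_measure; rewrite ?inE//.
- by apply: measurableI => //; exact: (measurable_semi_coord 0 [set z]).
- exact: measurable_preimage measurable_theta (mB m).
- move=> w [[[|j] jm Sj] /= wz]; first by rewrite wz in Sj.
  by exists j.
Qed.

Lemma semi_finite_hits K (w : semi_trajectory G) :
  exists N, forall n, w n \in K -> (n <= N)%N.
Proof.
have fin : finite_set [set n | w n \in K].
  have -> : [set n | w n \in K] = \bigcup_(x in [set` K]) [set n | w n = x].
    by apply/seteqP; split=> n /= => [wn|[x xK ->//]]; exists (w n).
  by apply: bigcup_finite => // x _; exact: semi_visits.
have /finite_seqP[s sE] := fin; exists (\max_(i <- s) i) => n wn.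
have : n \in s by have : [set n | w n \in K] n := wn; rewrite sE.
by move=> ns; exact: leq_bigmax_seq.
Qed.

Lemma measurable_no_return K : measurable (no_return K : set (semi_trajectory G)).
Proof.
rewrite (_ : no_return K = \bigcap_(n in [set n | (0 < n)%N])
    [set w : semi_trajectory G | [set x | x \notin K] (w n)]).
  by apply: bigcap_measurableType => n _; exact: measurable_semi_coord.
by apply/seteqP; split.
Qed.

(** For [y \in K], the event that the last visit to [K] takes place at [y]; the union over the time
    [j] of that visit is then disjoint. *)
Definition last_exit K y : set (semi_trajectory G) :=
  \bigcup_j ([set w : semi_trajectory G | w j = y] `&`
             iter j theta @^-1` no_return K).

Let measurable_exit_at K y j : measurable
  ([set w : semi_trajectory G | w j = y] `&` iter j theta @^-1` no_return K).
Proof.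
apply: measurableI; first exact: (measurable_semi_coord j [set y]).
exact: measurable_preimage (measurable_iter_theta j) (measurable_no_return K).
Qed.

Lemma measurable_last_exit K y : measurable (last_exit K y).
Proof. exact: bigcupT_measurable. Qed.

(** Last-exit decomposition: the Markov property at each fixed time [j] gives the factor
    [transition_iter j x y], and these add up to the Green function. *)
Lemma last_exit_measure K x y : y \in K ->
  P x (last_exit K y) = (green x y * P y (no_return K))%E.
Proof.
move=> yK; rewrite measure_semi_bigcup//; last 2 first.
- apply/trivIsetP => i j _ _.
  wlog ij : i j / (i < j)%N => [hw ij|_].
    have := ij; rewrite neq_ltn => /orP[/hw->//|/hw]; rewrite setIC => ->//.
    by rewrite eq_sym.
  rewrite -subset0 => w [[_ wi] [wj _]].
  have := wi (j - i)%N; rewrite subn_gt0 iter_thetaE subnKC ?(ltnW ij)//.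
  by move=> /(_ ij); rewrite wj yK.
- exact: bigcupT_measurable.
transitivity (\sum_(i <oo) (P y (no_return K) * (transition_iter i x y)%:E))%E.
  apply: eq_eseriesr => i _; rewrite muleC.
  by apply: markov_iter => //; exact: measurable_no_return.
have Py : P y (no_return K) = (fine (P y (no_return K)))%:E.
  by rewrite fineK// fin_num_measure//; exact: measurable_no_return.
rewrite Py nneseriesZl; last by move=> i _; rewrite lee_fin transition_iter_ge0.
by rewrite muleC.
Qed.

Lemma last_exit_cover K (w : semi_trajectory G) : w 0%N \in K ->
  exists2 y, y \in K & exists j, [/\ w j = y, no_return K (iter j theta w) &
    forall i, w i \in K -> (i <= j)%N].
Proof.
move=> w0; have [N wN] := semi_finite_hits K w.
have ex : exists n, w n \in K by exists 0%N.
case: (ex_maxnP ex wN) => j wj jmax; exists (w j) => //; exists j; split=> // n n0.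
rewrite iter_thetaE; apply/negP => /jmax.
by rewrite -{2}[j]addn0 leq_add2l leqNgt n0.
Qed.

Fixpoint ball x M : set G :=
  if M is M'.+1 then
    ball x M' `|` \bigcup_(z in ball x M') [set y | adj z y]
  else [set x].

Lemma finite_ball x M : finite_set (ball x M).
Proof.
elim: M => [|M IHM] /=; first exact: finite_set1.
rewrite finite_setU; split=> //; apply: bigcup_finite => // z _.
exact: adj_locally_finite.
Qed.

Lemma path_ball (w : semi_trajectory G) M j : (j <= M)%N -> ball (w 0%N) M (w j).
Proof.
elim: M j => [|M IHM] j; first by rewrite leqn0 => /eqP ->.
rewrite leq_eqVlt => /predU1P[->|jM]; last by left; exact: IHM.
by right; exists (w M); [exact: IHM|exact: semi_step].
Qed.

Lemma equilibrium_ge0 K x : (0 <= equilibrium P K x)%E.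
Proof.
rewrite /equilibrium; case: ifPn => // _.
by rewrite mule_ge0// lee_fin ltW// vertex_weight_gt0.
Qed.

(* The last exit from a large finite set sees a small Green function with high
   probability, so the exit law forces the equilibrium measure to be large. *)
Lemma capacity_unbounded (C : R) :
  exists K, (C%:E < \sum_(y \in [set` K]) equilibrium P K y)%E.
Proof.
apply: contrapT => /forallNP noK.
wlog C0 : C noK / 0 < C.
  move=> hw; apply: (hw (`|C| + 1)); last by rewrite ltr_wpDl.
  move=> K CK; apply: (noK K); apply: le_lt_trans CK.
  by rewrite lee_fin (le_trans (ler_norm _))// lerDl.
have {}noK K : (\sum_(y \in [set` K]) equilibrium P K y <= C%:E)%E.
  by rewrite leNgt; apply/negP; exact: noK.
have [z0 _] := adj_edge G.
pose a := @vertex_weight R G.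
have a0 x : 0 < a x by exact: vertex_weight_gt0.
(* With this [e], and with [M] large, each of the events in [cover] below has probability at most
   one quarter, although together they contain an event of probability 1. *)
pose e := (4 * C)^-1; have e0 : 0 < e by rewrite invr_gt0 mulr_gt0.
(* The threshold is proportional to [a y] for two reasons: on [S], reversibility turns it into the
   uniform bound [e * a z0 <= green y z0]; off [S], it bounds the probability of a last exit at [y]
   by [e * equilibrium P K y]. *)
pose S := [set y | ((e * a y)%:E <= green z0 y)%E].
have Sgreen y : S y -> ((e * a z0)%:E <= green y z0)%E.
  move=> Sy; rewrite -(@lee_pmul2l _ (a y)%:E)//; last by rewrite lte_fin.
  rewrite (green_reversible y z0) -EFinM mulrCA mulrA mulrC EFinM.
  by apply: lee_wpmul2l => //; rewrite lee_fin ltW.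
have [M sM] : exists M : nat, (green_tail M z0 z0 <= (e * a z0 / 4)%:E)%E.
  have /fine_cvgP[tfin /cvgr0Pnorm_le tail0] : green_tail M z0 z0 @[M --> \oo] --> 0%E.
    apply: nneseries_tail_cvg => [|k _]; first exact: network_transient.
    by rewrite lee_fin transition_iter_ge0.
  have ea : 0 < e * a z0 / 4 by rewrite divr_gt0// mulr_gt0.
  near \oo => M; exists M.
  rewrite -(@fineK _ (green_tail M z0 z0)); last by near: M.
  rewrite lee_fin (le_trans (ler_norm _))//.
  by near: M; exact: tail0.
(* The chain started at [z0] stays in [K] up to time [M], so its last visit to [K] happens at time
   [M] or later. *)
pose K := fset_set (ball z0 M).
have KE : [set` K] = ball z0 M by rewrite fset_setK//; exact: finite_ball.
pose S' := [set y | y \in K /\ ~ S y].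
have finS' : finite_set S' by apply: sub_finite_set (finite_fset K) => y [].
have cover : [set w : semi_trajectory G | w 0%N = z0] `<=`
    (\bigcup_(y in S') last_exit K y) `|` visits_from M S.
  move=> w /= wo; have wK j : (j <= M)%N -> w j \in K.
    by move=> jM; have : [set` K] (w j) by rewrite KE -wo; exact: path_ball.
  have [y yK [j [wj nr jmax]]] := last_exit_cover (wK 0%N isT).
  have [Sy|nSy] := pselect (S y); last by left; exists y => //; exists j.
  by right; exists j; [exact/jmax/wK|rewrite wj].
have mS' : measurable (\bigcup_(y in S') last_exit K y).
  by apply: fin_bigcup_measurable => // y _; exact: measurable_last_exit.
have mV : measurable (visits_from M S) by exact: measurable_visits_from.
have H1 : (P z0 (visits_from M S) <= (4^-1)%:E)%E.
  have := visits_from_le (mulr_gt0 e0 (a0 z0)) Sgreen M z0.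
  move=> /le_trans /(_ sM); rewrite EFinM -lee_pdivlMl ?mulr_gt0//.
  by rewrite -EFinM mulrA mulVf ?mul1r// gt_eqF// mulr_gt0.
have H2 : (P z0 (\bigcup_(y in S') last_exit K y) <= (4^-1)%:E)%E.
  apply: (@le_trans _ _ (\sum_(y \in S') P z0 (last_exit K y))%E).
    apply: content_sub_fsum => // y _; exact: measurable_last_exit.
  apply: (@le_trans _ _ (\sum_(y \in S') e%:E * equilibrium P K y)%E).
    apply: lee_fsum => // y [yK /negP]; rewrite -ltNge => Sy.
    rewrite last_exit_measure// /equilibrium yK muleA -EFinM.
    by apply: lee_wpmul2r => //; exact: ltW.
  rewrite -ge0_mule_fsumr; last by move=> y; exact: equilibrium_ge0.
  apply: (@le_trans _ _ (e%:E * C%:E)%E).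
    apply: lee_wpmul2l; first by rewrite lee_fin ltW.
    apply: le_trans (noK K); apply: lee_fsum_nneg_subset => //.
    - by move=> y; rewrite !inE => -[].
    - by move=> y _; exact: equilibrium_ge0.
  by rewrite -EFinM /e invfM -mulrA mulVf ?mulr1// gt_eqF.
have : (1 <= (4^-1)%:E + (4^-1)%:E :> \bar R)%E.
  rewrite -(start_measure P_law z0).
  apply: le_trans (leeD H2 H1).
  apply: le_trans (measureU2 _ mS' mV).
  apply: le_measure; rewrite ?inE//; last exact: measurableU.
  exact: (measurable_semi_coord 0 [set z0]).
by rewrite -EFinD lee_fin; lra.
Unshelve. all: by end_near.
Qed.

End capacity.

Lemma rectangle_measure_unique d1 d2 (T1 : measurableType d1)
    (T2 : measurableType d2) (R : realType)
    (m1 m2 : {measure set (T1 * T2) -> \bar R}) :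
  (forall A B, measurable A -> measurable B -> m1 (A `*` B) = m2 (A `*` B)) ->
  (m1 setT < +oo)%E -> forall X, measurable X -> m1 X = m2 X.
Proof.
move=> m12 m1oo.
pose C := [set A `*` B | A in @measurable _ T1 & B in @measurable _ T2].
apply: (measure_unique C (fun=> setT)) => //.
- exact: measurable_prod_measurableType.
- move=> _ _ [A mA [B mB <-]] [A' mA' [B' mB' <-]]; rewrite -setXI.
  by exists (A `&` A'); [exact: measurableI|exists (B `&` B') => //; exact: measurableI].
- by move=> _; exists setT => //; exists setT => //; rewrite setXTT.
- by apply/seteqP; split=> // t _; exists 0%N.
- by move=> _ [A mA [B mB <-]]; exact: m12.
Qed.

Lemma measure_cover0 d (T : measurableType d) (R : realType)
    (m : {measure set T -> \bar R}) (U : countType) (F : U -> set T) A :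
  measurable A -> (forall u, measurable (F u)) -> A `<=` \bigcup_u F u ->
  (forall u, m (A `&` F u) = 0%E) -> m A = 0%E.
Proof.
move=> mA mF AF mAF0.
pose F' n := if choice.unpickle n is Some u then A `&` F u else set0.
have mF' n : measurable (F' n).
  by rewrite /F'; case: choice.unpickle => // u; exact: measurableI.
apply/eqP; rewrite eq_le measure_ge0 andbT.
have AF' : A `<=` \bigcup_n F' n.
  move=> t At; have [u _ Fu] := AF _ At.
  by exists (choice.pickle u) => //; rewrite /F' choice.pickleK.
apply: (le_trans (measure_sigma_subadditive m mF' mA AF')).
rewrite eseries0// => n _ _; rewrite /F'.
by case: choice.unpickle => [u|]; [exact: mAF0|exact: measure0].
Qed.

(** * Zero-one law for a single trajectory *)

Section tail_shift.
Context {R : realType} {G : transient_network R}.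
Implicit Types (K : {fset G}) (v : semi_trajectory G) (w : trajectory G).

(** The maximum exists as soon as [K] is visited. The default value 0 makes [tail_shift K] the
    identity on trajectories that avoid [K]. *)
Definition last_visit K v : nat :=
  xget 0%N [set n | v n \in K /\ forall m, v m \in K -> (m <= n)%N].

Definition tail_shift K v : semi_trajectory G := iter (last_visit K v) theta v.

Lemma last_visitP K v : (exists n, v n \in K) ->
  v (last_visit K v) \in K /\ forall m, v m \in K -> (m <= last_visit K v)%N.
Proof.
move=> ex; have [N vN] := semi_finite_hits K v.
case: (ex_maxnP ex vN) => j vj jmax.
by rewrite /last_visit; case: xgetP => [n _ []|none]; [|case: (none j)].
Qed.

Lemma last_visit_unique K v n : v n \in K ->
  (forall m, v m \in K -> (m <= n)%N) -> last_visit K v = n.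
Proof.
move=> vn nmax; have [vl lmax] := @last_visitP K v (ex_intro _ n vn).
by apply/eqP; rewrite eqn_leq nmax//= lmax.
Qed.

(** Since [K] is visited at a positive time, so is it at its last visit, and the first vertex is not
    seen from there. *)
Lemma tail_shift_theta K v n : v n.+1 \in K ->
  tail_shift K (theta v) = tail_shift K v.
Proof.
move=> vn; have [tl tmax] := @last_visitP K (theta v) (ex_intro _ n vn).
rewrite /tail_shift -iterSr.
suff -> : last_visit K v = (last_visit K (theta v)).+1 by [].
by apply: last_visit_unique => // -[//|m] vm; rewrite ltnS; exact: tmax.
Qed.

Lemma measurable_tail_shift K : measurable_fun setT (tail_shift K).
Proof.
pose A j := [set v : semi_trajectory G | v j \in K /\
  forall m, v m \in K -> (m <= j)%N].
have mA j : measurable (A j).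
  apply: measurableI; first exact: (measurable_semi_coord j [set x | x \in K]).
  rewrite [X in measurable X](_ : _ = \bigcap_m
      [set v : semi_trajectory G | [set x | x \in K -> (m <= j)%N] (v m)]).
    by apply: bigcap_measurableType => m _; exact: measurable_semi_coord.
  by apply/seteqP; split=> [v vj m _|v vj m]; exact: vj.
have mN : measurable [set v : semi_trajectory G | forall m, v m \notin K].
  rewrite [X in measurable X](_ : _ = \bigcap_m
      [set v : semi_trajectory G | [set x | x \notin K] (v m)]).
    by apply: bigcap_measurableType => m _; exact: measurable_semi_coord.
  by apply/seteqP; split=> [v vj m _|v vj m]; exact: vj.
apply: measurable_fun_semi => n S.
under eq_set do rewrite iter_thetaE.
apply: (measurable_countable_cases (f := last_visit K)
  (A := fun j => [set v : semi_trajectory G | S (v (j + n)%N)])).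
  move=> j; rewrite (_ : _ @^-1` _ = A j `|`
      (if j == 0%N then [set v : semi_trajectory G | forall m, v m \notin K] else set0)).
    by apply: measurableU => //; case: ifP.
  apply/seteqP; split=> v /=; rewrite /last_visit.
    case: xgetP => [m _ + <-|none <-]; first by left.
    right; rewrite eqxx => m; apply/negP => vm.
    have [vl lmax] := @last_visitP K v (ex_intro _ m vm).
    by case: (none (last_visit K v)).
  move=> [[vj jmax]|]; first exact: last_visit_unique.
  case: eqP => // -> vn; case: xgetP => // m _ [vm _].
  by have := vn m; rewrite vm.
by move=> j; exact: measurable_semi_coord.
Qed.

(** If [w 0 \in K], the first hitting time is at most 0 and the last one at least 0; they are the
    last visits of the past and of the future of time 0. *)
Lemma out_traj_split K w : w 0 \in K ->
  out_traj K w = (tail_shift K (past_from w 0), tail_shift K (future_from w 0)).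
Proof.
move=> w0; have Kw : hitting K w by exists 0.
have [wf fmin] := first_hitP Kw; have [wl lmax] := last_hitP Kw.
congr pair; apply: semi_trajectory_ext => n; rewrite iter_thetaE /=.
  have f0 : first_hit K w <= 0 by exact: fmin.
  rewrite (@last_visit_unique _ _ `|first_hit K w|%N).
  - by congr (w _); lia.
  - by rewrite /= (_ : 0 - _ = first_hit K w)//; lia.
  - by move=> m /= wm; have := fmin _ wm; lia.
have l0 : 0 <= last_hit K w by exact: lmax.
rewrite (@last_visit_unique _ _ `|last_hit K w|%N).
- by congr (w _); lia.
- by rewrite /= (_ : 0 + _ = last_hit K w)//; lia.
- by move=> m /= wm; have := lmax _ wm; lia.
Qed.

End tail_shift.

(** * Measurability for trajectories modulo time shift *)

Section star_measurability.
Context {R : realType} {G : transient_network R}.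
Implicit Types (K : {fset G}).

Lemma measurable_starP (D : set (star G)) :
  measurable D <-> measurable (@pi_star R G @^-1` D).
Proof. by rewrite -[X in _ <-> measurable X]setTI. Qed.

Lemma measurable_hitting K : measurable (hitting K : set (trajectory G)).
Proof.
rewrite (_ : hitting K = \bigcup_n [set w : trajectory G | [set x | x \in K] (w n)]).
  apply: countable_bigcupT_measurable; first exact: countableP.
  by move=> n; exact: measurable_traj_coord.
by apply/seteqP; split=> [w [n wn]|w [n _ wn]]; exists n.
Qed.

Lemma pi_star_hitting K :
  @pi_star R G @^-1` hitting_star K = hitting K.
Proof. by apply/seteqP; split=> w /= /hitting_starE. Qed.

Lemma measurable_hitting_star K : measurable (hitting_star K : set (star G)).
Proof.
by apply/measurable_starP; rewrite pi_star_hitting; exact: measurable_hitting.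
Qed.

Lemma pi_star_surj (c : star G) : exists w, pi_star w = c.
Proof. by exists (repr c); rewrite /pi_star reprK. Qed.

Definition vertex_exhaustion n : {fset G} :=
  fset_set [set x : G | (choice.pickle x < n)%N].

Lemma vertex_exhaustionE n (x : G) :
  (x \in vertex_exhaustion n) = (choice.pickle x < n)%N.
Proof.
rewrite in_fset_set ?inE//.
  by apply/idP/idP; rewrite inE.
apply: (@finite_preimage _ _ `I_n (@choice.pickle G)); last exact: finite_II.
by move=> x1 x2 _ _; exact: (pcan_inj choice.pickleK).
Qed.

Lemma hitting_star_exhaustion (c : star G) :
  exists n, hitting_star (vertex_exhaustion n) c.
Proof.
have [w <-] := pi_star_surj c; exists (choice.pickle (w 0)).+1.
by apply/hitting_starE; exists 0; rewrite vertex_exhaustionE.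
Qed.

Lemma hitting_starS (K K' : {fset G}) : (K `<=` K')%fset ->
  hitting_star K `<=` (hitting_star K' : set (star G)).
Proof. by move=> /fsubsetP KK' _ [w [n /KK' wn] <-]; exists w => //; exists n. Qed.

End star_measurability.

(** * The intensity measure and its zero-one law *)

Section intensity.
Context {R : realType} {G : transient_network R}.
Variable P : G -> probability (semi_trajectory G) R.
Variable nuK : {fset G} -> {measure set (trajectory G) -> \bar R}.
Variable nu : {measure set (star G) -> \bar R}.
Hypothesis P_law : markov_chain_law P.
Hypothesis nuK_law : forall K : {fset G}, two_sided_law P K (nuK K).
Hypothesis nu_law : interlacement_intensity nuK nu.
Implicit Types (x : G) (K : {fset G}).

Definition split_at0 (w : trajectory G) : semi_trajectory G * semi_trajectory G :=
  (past_from w 0, future_from w 0).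

Lemma measurable_split_at0 : measurable_fun setT split_at0.
Proof.
by apply: measurable_fun_pair;
  [exact: measurable_past_from|exact: measurable_future_from].
Qed.

Let start_at x : set (trajectory G) := [set w : trajectory G | w 0 = x].

Let measurable_start_at x : measurable (start_at x).
Proof. exact: (measurable_traj_coord 0 [set x]). Qed.

(** The escape probability in the equilibrium measure cancels the normalisation of the conditional
    law; if it is 0, both sides vanish. The result is a product measure in [A] and [B]. *)
Lemma two_sided_rectangle K x (A B : set (semi_trajectory G)) :
  measurable A -> measurable B ->
  nuK K (split_at0 @^-1` (A `*` B) `&` [set w : trajectory G | w 0 = x]) =
  if x \in K then
    ((vertex_weight x)%:E * P x (A `&` no_return K) * P x B)%E
  else 0%E.
Proof.
move=> mA mB; have := nuK_law K x mA mB.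
rewrite [X in nuK K X](_ : _ = split_at0 @^-1` (A `*` B) `&`
    [set w : trajectory G | w 0 = x]); last first.
  by apply/seteqP; split=> w /=; [move=> [? ? ?]|move=> [[? ?] ?]].
move=> ->; rewrite /equilibrium; case: ifPn => xK; last by rewrite mule0 mul0e.
congr (_ * _)%E; rewrite /conditional_no_return muleCA; congr (_ * _)%E.
have mN := measurable_no_return K.
have Nfin : P x (no_return K) \is a fin_num by rewrite fin_num_measure.
have [N0|N0] := eqVneq (P x (no_return K)) 0%E.
  rewrite N0 mule0; apply/esym.
  exact: (subset_measure0 (measurableI _ _ mA mN) mN (@subIsetr _ _ _) N0).
have ANfin : P x (A `&` no_return K) \is a fin_num.
  by rewrite fin_num_measure//; exact: measurableI.
rewrite -[in X in (_ * X)%E](fineK Nfin) -EFinM divfK ?fineK//.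
by rewrite fine_eq0.
Qed.

Lemma intensity_start K x :
  nuK K [set w : trajectory G | w 0 = x] = equilibrium P K x.
Proof.
have := @two_sided_rectangle K x setT setT measurableT measurableT.
rewrite setXTT preimage_setT !setTI probability_setT mule1 => ->.
by rewrite /equilibrium.
Qed.

(** The vertex at time 0 lies in [K] almost everywhere, so the mass is the capacity of [K]. *)
Lemma intensity_mass K :
  nuK K setT = (\sum_(y \in [set` K]) equilibrium P K y)%E.
Proof.
have mK : measurable [set w : trajectory G | w 0 \in K].
  exact: (measurable_traj_coord 0 [set x | x \in K]).
transitivity (nuK K [set w : trajectory G | w 0 \in K]).
  rewrite -(setUv [set w : trajectory G | w 0 \in K]) measureU//; last 2 first.
  - exact: measurableC.
  - exact: setICr.
  rewrite [X in (_ + X)%E](_ : _ = 0%E) ?adde0//.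
  apply: (measure_cover0 (F := start_at)) => //.
  - exact: measurableC.
  - by move=> w _; exists (w 0).
  - move=> x; have [xK|xK] := boolP (x \in K).
      rewrite (_ : _ `&` _ = set0) ?measure0// -subset0 => w [/= wK wx].
      by apply: wK; rewrite wx.
    have x0 : nuK K (start_at x) = 0%E.
      by rewrite intensity_start /equilibrium (negbTE xK).
    apply: (subset_measure0 _ (measurable_start_at x) (@subIsetr _ _ _) x0).
    by apply: measurableI => //; exact: measurableC.
rewrite (_ : [set w : trajectory G | w 0 \in K] =
    \bigcup_(x in [set` K]) start_at x); last first.
  by apply/seteqP; split=> [w wK|w [x xK wx]];
    [exists (w 0)|rewrite /= (wx : w 0 = x)].
rewrite measure_fin_bigcup//.
- by apply: eq_fsbigr => x _; exact: intensity_start.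
- by apply/trivIsetP => x y _ _ xy; rewrite -subset0 => w [wx wy];
    move: xy; rewrite -wx -wy eqxx.
Qed.

Lemma intensity_hitting K : nu (hitting_star K) = nuK K setT.
Proof. by have := nu_law K measurableT; rewrite setTI preimage_setT. Qed.

Lemma intensity_hitting_lty K : (nu (hitting_star K) < +oo)%E.
Proof.
rewrite intensity_hitting intensity_mass fsbig_finite//=.
apply: lte_sum_pinfty => x _; rewrite /equilibrium; case: ifP => // _.
rewrite lte_mul_pinfty ?lee_fin ?(ltW (vertex_weight_gt0 x))//.
by rewrite (le_lt_trans (probability_le1 _ _)) ?ltry//; exact: measurable_no_return.
Qed.

Lemma intensity_hitting_unbounded (C : R) :
  exists K, (C%:E < nu (hitting_star K))%E.
Proof.
have [K CK] := capacity_unbounded P_law C; exists K.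
by rewrite intensity_hitting intensity_mass.
Qed.

(** On [w 0 = x] with [x \in K], the pair of past and future has law [vertex_weight x] times
    [P x \x P x] restricted to pasts that do not return to [K]; so it is absolutely continuous with
    respect to [P x \x P x]. *)
Lemma intensity_split_null K (c : set (semi_trajectory G * semi_trajectory G)) :
  measurable c -> (forall x, (P x \x P x)%E c = 0%E) ->
  nuK K (split_at0 @^-1` c) = 0%E.
Proof.
move=> mc c0; have msc := measurable_preimage measurable_split_at0 mc.
apply: (measure_cover0 (F := start_at)) => // [w _|x]; first by exists (w 0).
have [xK|xK] := boolP (x \in K); last first.
  have x0 : nuK K (start_at x) = 0%E.
    by rewrite intensity_start /equilibrium (negbTE xK).
  apply: (subset_measure0 _ (measurable_start_at x) (@subIsetr _ _ _) x0).
  exact: measurableI.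
have mN : measurable (no_return K `*` [set: semi_trajectory G]).
  by apply: measurableX => //; exact: measurable_no_return.
pose m1 : {measure set (semi_trajectory G * semi_trajectory G) -> \bar R} :=
  image_measure (mrestr (nuK K) (measurable_start_at x)) measurable_split_at0.
pose m2 : {measure set (semi_trajectory G * semi_trajectory G) -> \bar R} :=
  mscale (NngNum (ltW (vertex_weight_gt0 x))) (mrestr (P x \x P x)%E mN).
have m12 : m1 c = m2 c.
  apply: rectangle_measure_unique mc => [A B mA mB|].
    rewrite /m1 image_measureE /= /mrestr two_sided_rectangle// xK.
    rewrite /m2/= /mscale/= /mrestr -setXI setIT product_measure1E//.
      by rewrite muleA.
    by apply: measurableI => //; exact: measurable_no_return.
  rewrite /m1 image_measureE /= /mrestr preimage_setT setTI intensity_start.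
  rewrite -intensity_start.
  apply: le_lt_trans (intensity_hitting_lty K); rewrite intensity_hitting.
  by apply: le_measure; rewrite ?inE//; exact: (measurable_start_at x).
rewrite -[LHS]/(m1 c) m12 /m2/= /mscale/= /mrestr.
rewrite (_ : (P x \x P x)%E _ = 0%E) ?mule0//.
apply: (subset_measure0 _ mc (@subIsetl _ _ _) (c0 x)).
exact: measurableI.
Qed.

Lemma product_null x (c : set (semi_trajectory G * semi_trajectory G))
    (U : set (semi_trajectory G)) :
  measurable c -> measurable U -> P x U = 0%E ->
  (forall u, ~ U u -> P x (xsection c u) = 0%E) -> (P x \x P x)%E c = 0%E.
Proof.
move=> mc mU U0 cU; have mUT : measurable (U `*` [set: semi_trajectory G]).
  exact: measurableX.
apply/eqP; rewrite eq_le measure_ge0 andbT.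
apply: (@le_trans _ _ ((P x \x P x) (U `*` setT) +
    (P x \x P x) (c `\` (U `*` setT)))%E).
  apply: (le_trans _ (measureU2 _ _ _)) => //; last exact: measurableD.
  apply: le_measure; rewrite ?inE//.
    by apply: measurableU => //; exact: measurableD.
  by move=> t ct; have [Ut|] := pselect ((U `*` setT) t); [left|right].
have -> : (P x \x P x)%E (U `*` setT) = 0%E.
  transitivity (P x U * P x setT)%E; first exact: product_measure1E.
  by rewrite U0 mul0e.
rewrite add0e /product_measure1.
rewrite integral0_eq// => u _ /=.
have [Uu|nUu] := pselect (U u).
  rewrite (_ : xsection _ u = set0) ?measure0// -subset0 => v.
  by rewrite /xsection/= inE => -[_ []].
rewrite -[RHS](cU u nUu); congr (P x _).
apply/seteqP; split=> v; rewrite /xsection/= !inE; first by case.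
by move=> cuv; split=> // -[].
Qed.

(** Membership in [C] is rewritten as an event [c] of the past and the future at time 0. For a fixed
    past, the section of [c] is an invariant event, hence trivial; the set [U] of pasts with a full
    section is invariant too, hence trivial. By Fubini [c] or its complement is null for every
    [P x \x P x], and [intensity_split_null] carries this over to [nu]. *)
Theorem intensity_zero_one (P_tail : tail_trivial P) (C : set (star G)) :
  measurable C ->
  (forall K, exists2 B, measurable B &
    forall w, hitting K w -> (C (pi_star w) <-> B (out_traj K w))) ->
  nu C = 0%E \/ nu (~` C) = 0%E.
Proof.
move=> mC CB.
have {CB}/choice[B BP] : forall n, exists B, measurable B /\
    forall w, hitting (vertex_exhaustion n) w ->
      (C (pi_star w) <-> B (out_traj (vertex_exhaustion n) w)).
  by move=> n; have [B mB BC] := CB (vertex_exhaustion n); exists B.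
have mB n : measurable (B n) by have [] := BP n.
have {}BP n w : hitting (vertex_exhaustion n) w ->
    (C (pi_star w) <-> B n (out_traj (vertex_exhaustion n) w)).
  by have [_] := BP n; apply.
pose ts n := @tail_shift R G (vertex_exhaustion n).
(* The event [c] is invariant in each of its two arguments because, for [n]
   large, [ts n] does not see the first step of a trajectory. *)
pose c : set (semi_trajectory G * semi_trajectory G) :=
  [set p | exists N, forall n, (N <= n)%N -> B n (ts n p.1, ts n p.2)].
have mc : measurable c.
  rewrite (_ : c = \bigcup_N \bigcap_(n in [set n | (N <= n)%N])
      ((fun p => (ts n p.1, ts n p.2)) @^-1` B n)).
    apply: bigcupT_measurable => N; apply: bigcap_measurableType => n _.
    apply: measurable_preimage (mB n); apply: measurable_fun_pair.
      by apply: measurableT_comp => //; exact: measurable_tail_shift.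
    by apply: measurableT_comp => //; exact: measurable_tail_shift.
  by apply/seteqP; split=> [p [N Nn]|p [N _ Nn]]; exists N.
(* As soon as the [n]-th finite set contains [w 0], the condition inside [c] is equivalent to
   [C (pi_star w)]; so it holds for all large [n] or for none. *)
have cC w : C (pi_star w) <-> c (split_at0 w).
  have wn n : (choice.pickle (w 0) < n)%N ->
      (C (pi_star w) <-> B n (ts n (past_from w 0), ts n (future_from w 0))).
    rewrite -vertex_exhaustionE => w0.
    by rewrite -out_traj_split//; apply: BP; exists 0.
  split=> [Cw|[N NB]].
    by exists (choice.pickle (w 0)).+1 => n /wn[+ _]; exact.
  apply/(wn (maxn N (choice.pickle (w 0)).+1)); first by rewrite leq_maxr.
  by apply: NB; exact: leq_maxl.
have ts_theta n (v : semi_trajectory G) : (choice.pickle (v 1%N) < n)%N -> ts n (theta v) = ts n v.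
  by rewrite -vertex_exhaustionE; exact: tail_shift_theta.
have c_theta1 (u v : semi_trajectory G) : c (theta u, v) <-> c (u, v).
  split=> -[N NB]; exists (maxn N (choice.pickle (u 1%N)).+1) => n;
    by rewrite geq_max => /andP[Nn un]; have := NB _ Nn; rewrite /= ts_theta.
have c_theta2 (u v : semi_trajectory G) : c (u, theta v) <-> c (u, v).
  split=> -[N NB]; exists (maxn N (choice.pickle (v 1%N)).+1) => n;
    by rewrite geq_max => /andP[Nn un]; have := NB _ Nn; rewrite /= ts_theta.
have msec u : measurable (xsection c u) by exact: measurable_xsection.
have sec_inv u : invariant_event (xsection c u).
  split=> //; apply/seteqP; split=> v; rewrite /xsection /= !inE;
    by move=> /c_theta2.
have sec01 u := invariant_event_trivial P_law P_tail (sec_inv u).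
have [x0 _] := P_tail.
(* The choice of [x0] is immaterial: by [sec01] a section has the same probability, 0 or 1, from
   every starting vertex. *)
pose U := [set u | P x0 (xsection c u) = 1%E].
have mU : measurable U.
  have := measurable_fun_xsection (P x0) mc => /measurable_preimage.
  by move=> /(_ [set 1%E]); apply; exact: emeasurable_set1.
have inv_U : invariant_event U.
  split=> //; have secE u : xsection c (theta u) = xsection c u.
    by apply/seteqP; split=> v; rewrite /xsection /= !inE => /c_theta1.
  by apply/seteqP; split=> u; rewrite /U /= secE.
have secU u x : U u -> P x (xsection c u) = 1%E.
  by rewrite /U /= => Uu; have [/(_ x0)|//] := sec01 u; rewrite Uu => /eqP;
    rewrite onee_eq0.
have secNU u x : ~ U u -> P x (xsection c u) = 0%E.
  by move=> Uu; have [//|/(_ x0)] := sec01 u.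
(* Countably many sets [hitting_star K] with [K] finite cover the space, and on each of them [nu] is
   the image of [nuK K]. *)
have null D c' : measurable D -> measurable c' ->
    (forall w, D (pi_star w) -> c' (split_at0 w)) ->
    (forall x, (P x \x P x)%E c' = 0%E) -> nu D = 0%E.
  move=> mD mc' Dc' c'0.
  apply: (measure_cover0 (F := fun n : nat => hitting_star (vertex_exhaustion n))) => //.
  - by move=> n; exact: measurable_hitting_star.
  - by move=> d _; have [n] := hitting_star_exhaustion d; exists n.
  move=> n; rewrite nu_law//.
  have mD' : measurable (@pi_star R G @^-1` D) by exact/measurable_starP.
  apply: (subset_measure0 mD' (measurable_preimage measurable_split_at0 mc')) => //.
  exact: intensity_split_null.
have [U0|U1] := invariant_event_trivial P_law P_tail inv_U.
  left; apply: (null C c) => // [w|x]; first by rewrite cC.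
  by apply: (product_null mc mU (U0 x)) => u; exact: secNU.
right; apply: (null (~` C) (~` c)) => // [||w|x].
- exact: measurableC.
- exact: measurableC.
- by rewrite /= cC.
- apply: (@product_null _ _ (~` U)) => //.
  + exact: measurableC.
  + exact: measurableC.
  + by rewrite probability_setC// U1 subee.
  + move=> u /contrapT Uu; rewrite (_ : xsection _ u = ~` xsection c u).
      by rewrite probability_setC// secU// subee.
    by apply/seteqP; split=> v; rewrite /xsection /= !inE.
Qed.

End intensity.

(** * Point measures and configurations *)

Section point_measures.
Context d (T : measurableType d) (R : realType).
Implicit Types (mu : point_measure T R) (t : T) (D : set T).

Lemma point_measure_ext mu mu' : (forall D, mu D = mu' D) -> mu = mu'.
Proof.
case: mu mu' => [f fP] [g gP] /= /funext fg.
by case: _ / fg in gP *; congr PointMeasure; exact: Prop_irrelevance.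
Qed.

Lemma point_measure_measure mu :
  exists m : {measure set T -> \bar R}, forall D, mu D = m D.
Proof.
have [I [t muE]] := point_measureP mu.
pose s i : {measure set T -> \bar R} :=
  if i \in I then (\d_(t i) : {measure set T -> \bar R}) else mzero.
exists (mseries s 0) => D; rewrite muE esum_mkcond.
rewrite -[RHS]/(\sum_(0 <= k <oo) s k D)%E nneseries_esumT//.
by apply: eq_esum => i _; rewrite /s; case: ifP.
Qed.

Lemma point_measure_nat mu D : (mu D < +oo)%E -> exists k : nat, mu D = k%:R%:E.
Proof.
have [I [t ->]] := point_measureP mu => foo.
pose J := I `&` [set i | D (t i)].
have E : (\esum_(i in I) \d_(t i) D = \esum_(i in J) 1 :> \bar R)%E.
  rewrite esum_mkcondr; apply: eq_esum => i _.
  rewrite diracE (_ : (i \in _) = (t i \in D)); first by case: ifP.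
  by apply/idP/idP; rewrite !inE.
have [finJ|infJ] := pselect (finite_set J).
  by exists #|` fset_set J|; rewrite E finite_card_sum.
suff : (\esum_(i in J) 1 = +oo :> \bar R)%E by rewrite -E => Eoo; rewrite Eoo in foo.
rewrite -(@infinite_card_dirac _ nat R J infJ).
by apply: eq_esum => i Ji; rewrite diracE mem_set.
Qed.

Let add_pointP mu t : exists (I : set nat) (u : nat -> T), forall D,
  (mu D + \d_t D = \esum_(i in I) \d_(u i) D)%E.
Proof.
have [I [u muE]] := point_measureP mu.
exists ([set 0%N] `|` succn @` I), (fun n => if n is m.+1 then u m else t) => D.
rewrite (esumID [set 0%N])//.
rewrite setIUl setIid [X in _ `|` X](_ : _ = set0) ?setU0; last first.
  by rewrite -subset0 => n [[m _ <-]].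
rewrite esum_set1// addeC; congr (_ + _)%E.
rewrite setIUl setICr set0U setIidl; last by move=> n [m _ <-].
rewrite muE (@reindex_esum _ _ _ I (succn @` I) succn)//.
by split=> [i Ii|i j _ _ []//|i]; [exists i|].
Qed.

Definition pm_add mu t : point_measure T R := PointMeasure (add_pointP mu t).

Lemma pm_addE mu t D : pm_add mu t D = (mu D + \d_t D)%E.
Proof. by []. Qed.

Lemma measurable_fun_pm d' (S : measurableType d') (f : S -> point_measure T R) :
  (forall D, measurable D -> measurable_fun setT (fun s => f s D)) ->
  measurable_fun setT f.
Proof.
move=> mf; apply: (measurability (@point_measure_evaluations _ T R)) => //.
by move=> _ [_ [D mD [B mB <-]] <-]; rewrite !setTI; apply: measurable_preimage mB; exact: mf.
Qed.

Lemma measurable_dirac_eval D : measurable D ->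
  measurable_fun setT (fun t => \d_t D : \bar R).
Proof.
move=> mD; apply: (eq_measurable_fun (EFin \o \1_D)) => [t _|].
  by rewrite /= diracE indicE.
exact/measurable_EFinP/measurable_indic.
Qed.

Lemma measurable_pm_add mu : measurable_fun setT (pm_add mu).
Proof.
apply: measurable_fun_pm => D mD; apply: emeasurable_funD => //.
exact: measurable_dirac_eval.
Qed.

End point_measures.

Section configurations.
Context {R : realType} {G : transient_network R}.
Implicit Types (om : configuration G) (c : star G) (K : {fset G}).

Let cfg_add_lty om c K : (pm_add om c (hitting_star K) < +oo)%E.
Proof.
rewrite pm_addE lte_add_pinfty ?configuration_lt_pinfty//.
by rewrite diracE ltry.
Qed.

Definition cfg_add om c : configuration G := Configuration (cfg_add_lty om c).

Lemma cfg_addE om c D : cfg_add om c D = (om D + \d_c D)%E.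
Proof. by []. Qed.

Lemma measurable_cfg_eval (D : set (star G)) : measurable D ->
  measurable_fun setT (fun om : configuration G => om D).
Proof.
move=> mD; apply: measurable_fun_preimage => B mB.
by apply: sub_sigma_algebra; exists D => //; exists B => //; rewrite setTI.
Qed.

Lemma measurable_cfg_add :
  measurable_fun setT (fun p : configuration G * star G => cfg_add p.1 p.2).
Proof.
apply: (measurability (@configuration_evaluations R G)) => //.
move=> _ [_ [D mD [B mB <-]] <-]; rewrite !setTI.
apply: (@measurable_preimage _ _ _ _
  (fun p : configuration G * star G => (p.1 D + \d_(p.2) D)%E)) mB.
apply: emeasurable_funD.
  exact: measurableT_comp (measurable_cfg_eval mD) measurable_fst.
have mdD := @measurable_dirac_eval _ _ R D mD.
have msnd := @measurable_snd _ _ (configuration G) (star G).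
exact: (measurableT_comp mdD msnd).
Qed.

Lemma out_star_pi K (w : trajectory G) : hitting K w ->
  out_star K (pi_star w) = inl (out_traj K w).
Proof.
move=> Kw; rewrite /out_star asboolT; last exact/hitting_starE.
congr inl; apply: out_traj_translate; last by rewrite /pi_star reprK.
by apply/hitting_starE; rewrite /pi_star reprK; exact/hitting_starE.
Qed.

Lemma out_add K om c : out K (cfg_add om c) = pm_add (out K om) (out_star K c).
Proof. by apply: point_measure_ext => D; rewrite /= !diracE. Qed.

(** No trajectory meets [fset0], so [out fset0] keeps the whole configuration and only embeds it by
    [inr]. *)
Lemma measurable_non_local (A : set (configuration G)) :
  non_local_events A -> measurable A.
Proof.
move=> /(_ fset0 Logic.I) [B mB <-]; rewrite setTI; apply: measurable_preimage mB.
apply: measurable_fun_pm => D mD; rewrite /out /=.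
apply: measurable_cfg_eval.
rewrite (_ : out_star fset0 @^-1` D = inr @^-1` D); first by case: mD.
apply/seteqP; split=> c /=; rewrite /out_star asboolF//;
  by move=> [w [n]]; rewrite inE.
Qed.

Lemma measurable_cfg_add_section A om : measurable A ->
  measurable [set c : star G | A (cfg_add om c)].
Proof.
move=> mA; have := measurable_xsection om (measurable_preimage measurable_cfg_add mA).
by rewrite /xsection /=; under eq_set do rewrite inE.
Qed.

(** [A] is the preimage of some [B] under [out K], and adding [pi_star w] to [om] adds to [out K om]
    the single atom [inl (out_traj K w)]. This is how non-locality of [A] becomes a property of the
    two ends of one trajectory. *)
Lemma non_local_section A om K : non_local_events A ->
  exists2 B, measurable B & forall w, hitting K w ->
    (A (cfg_add om (pi_star w)) <-> B (out_traj K w)).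
Proof.
move=> /(_ K Logic.I) [B mB AE].
exists [set p | B (pm_add (out K om) (inl p))].
  apply: (@measurable_preimage _ _ _ _ (fun p => pm_add (out K om) (inl p))) mB.
  apply: (measurableT_comp (measurable_pm_add _)).
  by apply: measurable_fun_preimage => D [].
by move=> w Kw; rewrite -AE setTI /= out_add out_star_pi.
Qed.

End configurations.

(** * Uniqueness of laws on configurations *)

Lemma measure_eq_countable_union d (T : measurableType d) (R : realType)
    (m1 m2 : {measure set T -> \bar R}) (U : countType) (F : U -> set T) :
  (forall u, measurable (F u)) -> trivIset setT F ->
  (forall u, m1 (F u) = m2 (F u)) -> m1 (\bigcup_u F u) = m2 (\bigcup_u F u).
Proof.
move=> mF tF m12.
(* Several codes may decode to the same [u]; the test on [choice.pickle u] keeps one of them, so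
   that the sequence [F'] remains disjoint. *)
pose F' n := if choice.unpickle n is Some u then
  if choice.pickle u == n then F u else set0 else set0.
have mF' n : measurable (F' n).
  by rewrite /F'; case: choice.unpickle => // u; case: ifP.
have -> : \bigcup_u F u = \bigcup_n F' n.
  apply/seteqP; split=> t [u _].
    by move=> Fu; exists (choice.pickle u) => //; rewrite /F' choice.pickleK eqxx.
  by rewrite /F'; case: choice.unpickle => // v; case: ifP => // _ Fv; exists v.
have tF' : trivIset setT F'.
  apply/trivIsetP => i j _ _ ij; rewrite -subset0 => t [].
  rewrite /F'; case: choice.unpickle => // u; case: eqP => // ui Fu.
  case: choice.unpickle => // v; case: eqP => // vj Fv.
  move/trivIsetP : tF => /(_ u v Logic.I Logic.I).
  have uv : u != v by apply: contra ij => /eqP uv; rewrite -ui -vj uv.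
  by move=> /(_ uv); rewrite -subset0 => /(_ t); apply.
rewrite !measure_semi_bigcup//; try exact: bigcupT_measurable.
apply: eq_eseriesr => n _; rewrite /F'.
by case: choice.unpickle => [u|]; [case: ifP => _|]; rewrite ?measure0 ?m12.
Qed.

Section cylinders.
Context {R : realType} {G : transient_network R}.
Implicit Types (om : configuration G) (c : star G) (K : {fset G}) (D : set (star G)).

Definition bounded_star D := measurable D /\ exists K, D `<=` hitting_star K.

Lemma configuration_nat om D : bounded_star D -> exists k : nat, om D = k%:R%:E.
Proof.
move=> [mD [K DK]]; apply: point_measure_nat.
have [m omE] := point_measure_measure om; rewrite omE.
apply: (@le_lt_trans _ _ (m (hitting_star K))).
  by apply: le_measure; rewrite ?inE//; exact: measurable_hitting_star.
by rewrite -omE; exact: configuration_lt_pinfty.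
Qed.

Lemma measurable_cfg_eq D (x : \bar R) : measurable D ->
  measurable [set om : configuration G | om D = x].
Proof.
move=> mD.
exact: (measurable_preimage (measurable_cfg_eval mD) (emeasurable_set1 x)).
Qed.

Definition cylinder n (D : nat -> set (star G)) (k : nat -> nat) :
    set (configuration G) :=
  [set om : configuration G | forall i, (i < n)%N -> om (D i) = (k i)%:R%:E].

Lemma measurable_cylinder n (D : nat -> set (star G)) k : (forall i, measurable (D i)) ->
  measurable (cylinder n D k).
Proof.
move=> mD; rewrite (_ : cylinder n D k = \bigcap_(i in `I_n)
    [set om : configuration G | om (D i) = (k i)%:R%:E]).
  by apply: bigcap_measurableType => i _; exact: measurable_cfg_eq.
by apply/seteqP; split=> om omk i; exact: omk.
Qed.

Lemma configuration_cvg om D : measurable D ->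
  om (D `&` hitting_star (vertex_exhaustion n)) @[n --> \oo] --> om D.
Proof.
move=> mD; have [m omE] := point_measure_measure om.
under eq_fun do rewrite omE.
have DE : D = \bigcup_n (D `&` hitting_star (vertex_exhaustion n)).
  apply/seteqP; split=> [c Dc|c [n _ []]//].
  by have [n cn] := hitting_star_exhaustion c; exists n.
have <- : m (\bigcup_n (D `&` hitting_star (vertex_exhaustion n))) = om D.
  by rewrite -DE omE.
apply: nondecreasing_cvg_mu.
- by move=> n; apply: measurableI => //; exact: measurable_hitting_star.
- by rewrite -DE.
- move=> i j ij; apply/subsetPset; apply: setIS; apply: hitting_starS.
  by apply/fsubsetP => x; rewrite !vertex_exhaustionE => /leq_trans; exact.
Qed.

(** On bounded sets the counts are natural numbers, so their events are countable unions of
    cylinders; the count of an arbitrary measurable set is a limit of counts of its bounded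
    parts. *)
Lemma configuration_measure_unique
    (m1 m2 : {measure set (configuration G) -> \bar R}) :
  (m1 setT < +oo)%E ->
  (forall n (D : nat -> set (star G)) k, (forall i, bounded_star (D i)) ->
    m1 (cylinder n D k) = m2 (cylinder n D k)) ->
  forall A, measurable A -> m1 A = m2 A.
Proof.
move=> m1oo m12.
pose C : set (set (configuration G)) := [set A | exists n (D : nat -> set (star G)) k,
  (forall i, bounded_star (D i)) /\ A = cylinder n D k].
have C_T : C setT.
  exists 0%N, (fun=> set0), (fun=> 0%N); split; last by apply/seteqP; split.
  by move=> _; split => //; exists fset0.
apply: (measure_unique C (fun=> setT)) => //.
- apply/seteqP; split; last first.
    apply: smallest_sub; first exact: smallest_sigma_algebra.
    by move=> _ [n [D [k [bD ->]]]]; apply: measurable_cylinder => i;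
      have [] := bD i.
  apply: smallest_sub; first exact: smallest_sigma_algebra.
  move=> _ [D mD [B mB <-]]; rewrite setTI.
  pose f n (om : g_sigma_algebraType C) : \bar R :=
    (om : configuration G) (D `&` hitting_star (vertex_exhaustion n)).
  have mf n : measurable_fun setT (f n).
    apply: measurable_fun_preimage => B' mB'.
    have bDn : bounded_star (D `&` hitting_star (vertex_exhaustion n)).
      by split; [apply: measurableI => //; exact: measurable_hitting_star
        |exists (vertex_exhaustion n) => c []].
    rewrite (_ : f n @^-1` B' = \bigcup_k (if `[< B' k%:R%:E >] then
        cylinder 1 (fun=> D `&` hitting_star (vertex_exhaustion n)) (fun=> k)
        else set0)).
      apply: bigcupT_measurable => k; case: ifP => // _.
      by apply: sub_sigma_algebra; do 3 eexists; split; last reflexivity.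
    apply/seteqP; split=> om.
      have [k omk] := configuration_nat om bDn.
      rewrite /f /= omk => B'k; exists k => //.
      by rewrite asboolT// => i.
    move=> [k _]; case: asboolP => // B'k /(_ 0%N isT) omk.
    by rewrite /f /= omk.
  have mD' : measurable_fun setT
      (fun om : g_sigma_algebraType C => (om : configuration G) D : \bar R).
    apply: (emeasurable_fun_cvg f _ mf) => om _.
    exact: configuration_cvg.
  exact: (measurable_preimage mD' mB).
- move=> _ _ [n [D [k [bD ->]]]] [n' [D' [k' [bD' ->]]]].
  exists (n + n')%N, (fun i => if (i < n)%N then D i else D' (i - n)%N),
    (fun i => if (i < n)%N then k i else k' (i - n)%N); split.
    by move=> i; case: ifP.
  apply/seteqP; split=> om.
    move=> [omD omD'] i inn; case: ltnP => ni; first exact: omD.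
    by apply: omD'; rewrite ltn_subLR.
  move=> omDD; split=> i ni.
    by have := omDD i; rewrite ni; apply; rewrite ltn_addr.
  have nin : (n + i < n)%N = false by rewrite ltnNge leq_addr.
  by have := omDD (n + i)%N; rewrite ltn_add2l nin addKn; exact.
- by apply/seteqP; split=> // om _; exists 0%N.
- by move=> _ [n [D [k [bD ->]]]]; exact: m12.
Qed.

Lemma configuration_bigcup om n (E : 'I_n -> set (star G)) (J : {set 'I_n}) :
  (forall i, measurable (E i)) -> trivIset setT E ->
  om (\bigcup_(i in [set` J]) E i) = (\sum_(i in J) om (E i))%E.
Proof.
move=> mE tE; have [m omE] := point_measure_measure om; rewrite omE.
rewrite measure_fin_bigcup//; last exact: sub_trivIset tE.
rewrite -(@bigfs _ _ _ _ (index_enum 'I_n) (mem J))//; last 2 first.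
- exact: index_enum_uniq.
- by move=> i _; rewrite mem_index_enum.
by apply: eq_bigr => i _; rewrite omE.
Qed.

(** The sets of a cylinder, together with [D0], are cut into the atoms that they generate; the
    cylinder is then a countable disjoint union of events fixing the counts of all atoms. Adding
    [D0] to the family makes it a union of cells, so that its own count is known on each such
    event. *)
Lemma configuration_measure_unique_disjoint (D0 : set (star G))
    (m1 m2 : {measure set (configuration G) -> \bar R}) :
  bounded_star D0 -> (m1 setT < +oo)%E ->
  (forall n (E : 'I_n -> set (star G)) (J : {set 'I_n}) (k : 'I_n -> nat),
    (forall i, bounded_star (E i)) -> trivIset setT E ->
    D0 = \bigcup_(i in [set` J]) E i ->
    let H := [set om : configuration G | forall i, om (E i) = (k i)%:R%:E] in
    m1 H = m2 H) ->
  forall A, measurable A -> m1 A = m2 A.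
Proof.
move=> bD0 m1oo m12; apply: configuration_measure_unique => // n D k bD.
pose D' (i : 'I_n.+1) := if (i < n)%N then D i else D0.
have bD' i : bounded_star (D' i) by rewrite /D'; case: ifP.
have mD' i : measurable (D' i) by have [] := bD' i.
pose sig c := finset (fun i => `[< D' i c >]).
(* Points in none of the sets are left out: their atom need not be bounded. *)
pose atom (T : {set 'I_n.+1}) := [set c | sig c = T /\ T != finset.set0].
pose N := #|{set 'I_n.+1}|.
pose E (j : 'I_N) := atom (enum_val j).
have sigP c i : (i \in sig c) <-> D' i c.
  by rewrite finset.inE; split=> /asboolP.
have bE j : bounded_star (E j).
  have [T0|/set0Pn[i iT]] := eqVneq (enum_val j) finset.set0.
    rewrite (_ : E j = set0); last by rewrite -subset0 => c [_]; rewrite T0 eqxx.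
    by split => //; exists fset0.
  have EE : E j = \bigcap_(l in [set: 'I_n.+1])
      (if l \in enum_val j then D' l else ~` D' l).
    apply/seteqP; split=> c.
      move=> [<- _] l _; case: ifP => [/sigP//|/negP nl Dl].
      by apply: nl; exact/sigP.
    move=> Dc; split; last by apply/set0Pn; exists i.
    apply/setP => l; apply/idP/idP => [/sigP|lT]; have := Dc l Logic.I.
      by case: ifP.
    by rewrite lT => ?; exact/sigP.
  rewrite EE; split.
    apply: fin_bigcap_measurable => [|l _]; first exact: finite_finset.
    by case: ifP => // _; exact: measurableC.
  have [_ [K DK]] := bD' i; exists K => c /(_ i Logic.I).
  by rewrite iT => /DK.
have tE : trivIset setT E.
  apply/trivIsetP => i j _ _ ij; rewrite -subset0 => c [[ci _] [cj _]].
  by move/eqP: ij; apply; apply: enum_val_inj; rewrite -ci -cj.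
have D'E i : D' i = \bigcup_(j in [set` finset (fun j : 'I_N => i \in enum_val j)]) E j.
  apply/seteqP; split=> c.
    move=> /sigP ic; exists (enum_rank (sig c)); rewrite /= ?finset.inE ?enum_rankK//.
    by rewrite /E enum_rankK; split=> //; apply/set0Pn; exists i.
  by move=> [j /=]; rewrite finset.inE => ij [cj _]; apply/sigP; rewrite cj.
pose H (f : {ffun 'I_N -> nat}) :=
  [set om : configuration G | forall j, om (E j) = (f j)%:R%:E].
(* Only the counts of the [D i] with [i < n] are prescribed; that of [D0], which has index [n],
   stays free. *)
pose ok (f : {ffun 'I_N -> nat}) := [forall i : 'I_n,
  (\sum_(j in finset (fun j : 'I_N => widen_ord (leqnSn n) i \in enum_val j)) f j)%N
    == k i].
have cylE : cylinder n D k = \bigcup_f (if ok f then H f else set0).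
  have sumE om f i : H f om -> om (D' i) =
      (\sum_(j in finset (fun j : 'I_N => i \in enum_val j)) f j)%N%:R%:E.
    move=> Hf; rewrite D'E configuration_bigcup//; last by move=> j; case: (bE j).
    by rewrite natr_sum -sumEFin; apply: eq_bigr => j _; exact: Hf.
  have wE i : D' (widen_ord (leqnSn n) i) = D i by rewrite /D' /= ltn_ord.
  apply/seteqP; split=> om.
    move=> omD; have [f Hf] : exists f, H f om.
      have /choice[f fP] j := configuration_nat om (bE j).
      by exists (finfun f) => j; rewrite ffunE.
    exists f => //; case: ifP => // /negP; apply; apply/forallP => i.
    have := omD i (ltn_ord i); rewrite -wE (sumE _ _ _ Hf) => -[] /eqP.
    by rewrite eqr_nat.
  move=> [f _]; case: ifP => // /forallP okf Hf i ni.
  have := okf (Ordinal ni) => /eqP <-.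
  by rewrite -(sumE _ _ _ Hf) wE.
have mH f : measurable (H f).
  rewrite (_ : H f = \bigcap_j [set om : configuration G | om (E j) = (f j)%:R%:E]).
    apply: fin_bigcap_measurable => [|j _]; first exact: finite_finset.
    by apply: measurable_cfg_eq; case: (bE j).
  by apply/seteqP; split=> [om Hf j _|om Hf j];
    [exact: Hf|exact: (Hf j Logic.I)].
rewrite cylE; apply: measure_eq_countable_union.
- by move=> f; case: ifP.
- apply/trivIsetP => f g _ _ fg; rewrite -subset0 => om.
  case: ifP => _ [] //; case: ifP => // _ Hf Hg.
  move/eqP: fg; apply; apply/ffunP => j.
  by have := Hf j; rewrite (Hg j) => -[] /eqP; rewrite eqr_nat => /eqP.
- move=> f; case: ifP => _; last by rewrite !measure0.
  apply: (m12 _ E (finset (fun j : 'I_N => ord_max \in enum_val j)) f) => //.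
  by rewrite -D'E /D' /= ltnn.
Qed.

End cylinders.

(** * Mecke's equation *)

Section poisson_pmf.
Context {R : realType}.

(* Unlike the library's [poisson_pmf], this is the Poisson mass function even
   at rate [0]. *)
Definition pois (a : R) (k : nat) : R := a ^+ k / k`!%:R * expR (- a).

Lemma pois_ge0 a k : 0 <= a -> 0 <= pois a k.
Proof. by move=> a0; rewrite mulr_ge0 ?expR_ge0// divr_ge0// exprn_ge0. Qed.

(** Mecke's equation for a single Poisson variable; it also yields the Poisson moments. *)
Lemma poisS a k : k.+1%:R * pois a k.+1 = a * pois a k.
Proof.
rewrite /pois factS natrM exprS !mulrA; congr (_ * _).
have k0 : k.+1%:R != 0 :> R by rewrite pnatr_eq0.
have f0 : k`!%:R != 0 :> R by rewrite pnatr_eq0 -lt0n fact_gt0.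
by field; rewrite f0 addrC natr1.
Qed.

End poisson_pmf.

Section mecke.
Context {R : realType} {G : transient_network R}.
Variable nu : {measure set (star G) -> \bar R}.
Variable Q : probability (configuration G) R.
Hypothesis nu_lty : forall K : {fset G}, (nu (hitting_star K) < +oo)%E.
Hypothesis Q_law : poisson_point_process nu Q.
Implicit Types (om : configuration G) (c : star G) (D : set (star G)).

Lemma bounded_star_lty D : bounded_star D -> (nu D < +oo)%E.
Proof.
move=> [mD [K DK]]; apply: le_lt_trans (nu_lty K).
by apply: le_measure; rewrite ?inE//; exact: measurable_hitting_star.
Qed.

Lemma poisson_disjoint n (E : 'I_n -> set (star G)) (k : 'I_n -> nat) :
  (forall i, bounded_star (E i)) -> trivIset setT E ->
  Q [set om : configuration G | forall i, om (E i) = (k i)%:R%:E] =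
  (\prod_(i < n) pois (fine (nu (E i))) (k i))%:E.
Proof.
move=> bE tE; have [Qpois _ Qind] := Q_law.
have mE i : measurable (E i) by have [] := bE i.
have := Qind n E (fun i => [set (k i)%:R%:E]) mE tE
  (fun i => emeasurable_set1 _) => /= ->.
rewrite -prodEFin; apply: eq_bigr => i _.
by rewrite Qpois//; exact: bounded_star_lty.
Qed.

(** Mecke's equation for one cell: a point added in [E j] raises the [j]-th count only, and by
    independence [poisS] applies to the [j]-th factor alone. *)
Let poisson_shift n (E : 'I_n -> set (star G)) (k : 'I_n -> nat) j :
  (forall i, bounded_star (E i)) -> trivIset setT E ->
  (Q [set om : configuration G | forall i,
      (om (E i) + (i == j)%:R%:E = (k i)%:R%:E)%E] * nu (E j) =
  (k j)%:R%:E * Q [set om : configuration G | forall i, om (E i) = (k i)%:R%:E])%E.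
Proof.
move=> bE tE; have nuE : nu (E j) = (fine (nu (E j)))%:E.
  by rewrite fineK// ge0_fin_numE// bounded_star_lty.
case kj : (k j) => [|l].
  rewrite mul0e (_ : [set om | _] = set0) ?measure0 ?mul0e//.
  rewrite -subset0 => om /(_ j); rewrite eqxx kj.
  have [a ->] := configuration_nat om (bE j).
  by rewrite -EFinD => -[]; rewrite natr1 => /eqP; rewrite pnatr_eq0.
pose k' i := if i == j then l else k i.
rewrite (_ : [set om : configuration G | forall i,
    (om (E i) + (i == j)%:R%:E = (k i)%:R%:E)%E] =
    [set om : configuration G | forall i, om (E i) = (k' i)%:R%:E]); last first.
  have shiftE om i : (om (E i) + (i == j)%:R%:E = (k i)%:R%:E)%E <->
      om (E i) = (k' i)%:R%:E.
    rewrite /k'; case: eqP => [->|_]; last by rewrite adde0.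
    have [a ->] := configuration_nat om (bE j).
    rewrite kj -EFinD natr1; split=> -[] /eqP; rewrite eqr_nat.
      by rewrite eqSS => /eqP ->.
    by move=> /eqP ->.
  by apply/seteqP; split=> om omE i; apply/shiftE.
rewrite !poisson_disjoint// nuE -!EFinM; congr EFin.
rewrite (bigD1 j)//= [in RHS](bigD1 j)//= {1}/k' eqxx kj.
rewrite [X in _ * X * _](_ : _ = \prod_(i < n | i != j) pois (fine (nu (E i))) (k i)).
  by rewrite [RHS]mulrA poisS mulrC mulrA.
by apply: eq_bigr => i /negbTE ij; rewrite /k' ij.
Qed.

(* Mecke's equation [E[om D; A] = \int_D Q(om + \d_c \in A) nu(dc)], split
   according to the value of [om D]. *)
Theorem mecke_count D (mD : measurable D) (Doo : (nu D < +oo)%E) m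
    (A : set (configuration G)) : bounded_star D -> measurable A ->
  (m.+1%:R%:E * Q (A `&` [set om : configuration G | om D = m.+1%:R%:E]) =
  (Q \x mfrestr mD Doo)
    ([set p : configuration G * star G | p.1 D = m%:R%:E /\ A (cfg_add p.1 p.2)]))%E.
Proof.
move=> bD mA; pose nuD := mfrestr mD Doo.
have mS1 : measurable [set om : configuration G | om D = m.+1%:R%:E].
  exact: measurable_cfg_eq.
have mS2 : measurable [set p : configuration G * star G | p.1 D = m%:R%:E].
  exact: (measurable_preimage measurable_fst (measurable_cfg_eq _ mD)).
pose m1 : {measure set (configuration G) -> \bar R} :=
  mscale (NngNum (ler0n R m.+1)) (mrestr Q mS1).
pose m2 : {measure set (configuration G) -> \bar R} :=
  image_measure (mrestr (Q \x nuD)%E mS2) measurable_cfg_add.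
(* Both sides are measures in [A]; it is enough to compare them on events that fix the counts of
   disjoint cells, some of which make up [D]. *)
suff : m1 A = m2 A.
  rewrite /m1 /m2 image_measureE /= /mscale /mrestr /= => ->.
  by congr ((Q \x nuD)%E _); rewrite setIC.
apply: (configuration_measure_unique_disjoint bD) mA.
  rewrite /m1 /= /mscale /= /mrestr setTI lte_mul_pinfty ?lee_fin//.
  by rewrite (le_lt_trans (probability_le1 _ _)) ?ltry.
move=> n E J k bE tE DE H.
have mE i : measurable (E i) by have [] := bE i.
have HD om : H om -> om D = (\sum_(i in J) k i)%N%:R%:E.
  move=> Hom; rewrite DE configuration_bigcup// natr_sum -sumEFin.
  by apply: eq_bigr => i _; exact: Hom.
have EjD j : j \in J -> E j `<=` D by move=> jJ c Ejc; rewrite DE; exists j.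
have diracE' c j i : E j c -> \d_c (E i) = (i == j)%:R%:E :> \bar R.
  move=> Ejc; rewrite diracE; have [->|ij] := eqVneq i j; first by rewrite mem_set.
  rewrite memNset// => Eic; move/trivIsetP : tE => /(_ i j Logic.I Logic.I ij).
  by rewrite -subset0 => /(_ c); apply.
have mH : measurable H.
  rewrite (_ : H = \bigcap_j [set om : configuration G | om (E j) = (k j)%:R%:E]).
    apply: fin_bigcap_measurable => [|j _]; first exact: finite_finset.
    exact: measurable_cfg_eq.
  by apply/seteqP; split=> [om Hf j _|om Hf j];
    [exact: Hf|exact: (Hf j Logic.I)].
pose Hj j := [set om : configuration G | forall i,
  (om (E i) + (i == j)%:R%:E = (k i)%:R%:E)%E].
have mHj j : measurable (Hj j).
  rewrite (_ : Hj j = \bigcap_i [set om : configuration G |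
      (om (E i) + (i == j)%:R%:E = (k i)%:R%:E)%E]).
    apply: fin_bigcap_measurable => [|i _]; first exact: finite_finset.
    have mf : measurable_fun setT
        (fun om : configuration G => (om (E i) + (i == j)%:R%:E)%E).
      by apply: emeasurable_funD => //; exact: measurable_cfg_eval.
    exact: (measurable_preimage mf (emeasurable_set1 _)).
  by apply/seteqP; split=> [om Hf i _|om Hf i];
    [exact: Hf|exact: (Hf i Logic.I)].
rewrite /m1 /m2 image_measureE /= /mscale /= /mrestr /=.
set X := (X in product_measure1 _ _ X).
have mX : measurable X.
  apply: measurableI => //; exact: measurable_preimage measurable_cfg_add mH.
have mTD : measurable ([set: configuration G] `*` D) by exact: measurableX.
rewrite (measureDI (Q \x nuD)%E mX mTD).
rewrite [X in (X + _)%E](_ : _ = 0%E); last first.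
  have mTDc : measurable ([set: configuration G] `*` ~` D).
    by apply: measurableX => //; exact: measurableC.
  apply: (subset_measure0 (measurableD mX mTD) mTDc).
    by move=> p [_ pD]; split=> // Dp; apply: pD.
  transitivity (Q setT * nuD (~` D))%E.
    by apply: product_measure1E => //; exact: measurableC.
  by rewrite /nuD /= /mfrestr /mrestr setICl measure0 mule0.
rewrite add0e.
(* On [H] the count of [D] is the sum of the [k i] over the cells in [D]; unless this is [m.+1],
   both sides are 0. *)
have [km|km] := eqVneq (\sum_(i in J) k i)%N m.+1; last first.
  rewrite (_ : H `&` _ = set0) ?measure0 ?mule0; last first.
    rewrite -subset0 => om [/HD /= ->] [] /eqP; rewrite eqr_nat.
    by rewrite (negbTE km).
  rewrite (_ : X `&` _ = set0) ?measure0// -subset0 => -[om c] [[/= + omD] [_ /= Dc]].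
  move=> /HD; rewrite cfg_addE omD diracE mem_set//= -EFinD natr1 => -[] /eqP.
  by rewrite eqr_nat eq_sym (negbTE km).
rewrite (_ : H `&` _ = H); last first.
  by apply/setIidl => om /HD; rewrite km.
(* The added point lies in exactly one cell [E j] of [D]. By [poisson_shift] that cell contributes
   [k j] times [Q H], and the [k j] add up to [m.+1]. *)
rewrite (_ : X `&` _ = \bigcup_(j in [set` J]) (Hj j `*` E j)); last first.
  apply/seteqP; split=> [[om c] [[/= Hc omD] [_ /= Dc]]|[om c] [j jJ [/= Hom Ec]]].
    move: Dc; rewrite DE => -[j jJ Ec]; exists j => //; split=> //= i.
    by have := Hc i; rewrite cfg_addE (diracE' _ j).
  have Hc : H (cfg_add om c) by move=> i; rewrite cfg_addE (diracE' _ j).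
  split; last by split=> //=; exact: EjD Ec.
  split=> //=; have := HD _ Hc; rewrite km cfg_addE diracE mem_set; last exact: EjD Ec.
  have [a ->] := configuration_nat om bD.
  by rewrite -EFinD natr1 => -[] /eqP; rewrite eqr_nat eqSS => /eqP ->.
rewrite measure_fin_bigcup//; last 2 first.
- apply/trivIsetP => i j _ _ ij; rewrite -subset0 => -[om c] [[_ /= Eic] [_ /= Ejc]].
  move/trivIsetP : tE => /(_ i j Logic.I Logic.I ij).
  by rewrite -subset0 => /(_ c); apply.
- by move=> j _; exact: measurableX.
rewrite -(@bigfs _ _ _ _ (index_enum 'I_n) (mem J))//; last 2 first.
- exact: index_enum_uniq.
- by move=> i _; rewrite mem_index_enum.
rewrite (eq_bigr (fun j => (k j)%:R%:E * Q H)%E) => [|j jJ].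
  rewrite -ge0_sume_distrl// sumEFin -natr_sum.
  by rewrite (km : (\sum_(i < n | mem J i) k i)%N = m.+1).
rewrite -poisson_shift//.
transitivity (Q (Hj j) * nuD (E j))%E; first exact: product_measure1E.
by congr (_ * _)%E; rewrite /nuD /= /mfrestr /mrestr setIidl//; exact: EjD.
Qed.

End mecke.

(** * Zero-one law for Poisson configurations *)

Section poisson_deviation.
Context {R : realType}.
Implicit Types (f g : nat -> R) (a : R).
Local Open Scope ereal_scope.

Let S f : \bar R := \sum_(0 <= k <oo) (f k)%:E.

Let SD f g : (forall k, 0 <= f k)%R -> (forall k, 0 <= g k)%R ->
  S (fun k => f k + g k)%R = S f + S g.
Proof.
by move=> f0 g0; rewrite /S -nneseriesD// => k _ _; rewrite lee_fin.
Qed.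

Let SZ a f : (forall k, 0 <= f k)%R -> S (fun k => a * f k)%R = a%:E * S f.
Proof. by move=> f0; rewrite /S -nneseriesZl// => k _; rewrite lee_fin. Qed.

Let SS f : (forall k, 0 <= f k)%R -> S f = (f 0%N)%:E + S (fun k => f k.+1).
Proof.
move=> f0; have f0' k : 0 <= (f k)%:E by rewrite lee_fin.
rewrite /S nneseries_recl//; congr (_ + _).
rewrite -(@nneseries_addn _ (fun k => (f k)%:E) 1)//.
by apply: eq_eseriesr => k _; rewrite addn1.
Qed.

Let leS f g : (forall k, 0 <= f k)%R -> (forall k, f k <= g k)%R -> S f <= S g.
Proof. by move=> f0 fg; apply: lee_nneseries => // k _; rewrite lee_fin. Qed.

Let eqS f g : f =1 g -> S f = S g.
Proof. by move=> fg; apply: eq_eseriesr => k _; rewrite fg. Qed.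

(** By [poisS] the mean is [a] and the second moment [a * (a + 1)], so the variance is [a]. The
    absolute deviation is compared with the variance pointwise, with weight [Num.sqrt a], which
    replaces the Cauchy-Schwarz inequality. *)
Lemma pois_deviation a : (0 < a)%R -> \sum_(0 <= k <oo) (pois a k)%:E = 1 ->
  \sum_(0 <= k <oo) (`|k%:R - a| * pois a k)%:E <= (Num.sqrt a)%:E.
Proof.
move=> a0 p1; have p0 k : (0 <= pois a k)%R by rewrite pois_ge0// ltW.
have S1 : S (pois a) = 1 by exact: p1.
have M1 : S (fun k => k%:R * pois a k)%R = a%:E.
  rewrite SS => [|k]; last by rewrite mulr_ge0.
  rewrite mul0r add0e -[RHS]mule1 -S1 -SZ//.
  by apply: eqS => k; rewrite poisS.
have M2 : S (fun k => k%:R ^+ 2 * pois a k)%R = (a * (a + 1))%:E.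
  rewrite SS => [|k]; last by rewrite mulr_ge0// sqr_ge0.
  rewrite expr0n mul0r add0e.
  rewrite (eqS (g := fun k => a * (k%:R * pois a k + pois a k))%R) => [|k].
    rewrite SZ => [|k]; last by rewrite addr_ge0// mulr_ge0.
    by rewrite SD// ?M1 ?S1// => k; rewrite mulr_ge0.
  rewrite expr2 -mulrA poisS mulrCA; congr (_ * _)%R.
  by rewrite -natr1 mulrDl mul1r.
have V : S (fun k => (k%:R - a) ^+ 2 * pois a k)%R = a%:E.
  have W0 k : (0 <= (k%:R - a) ^+ 2 * pois a k)%R by rewrite mulr_ge0// sqr_ge0.
  (* The expanded square is arranged with nonnegative terms on both sides, so that no series in the
     extended reals has to be subtracted. *)
  have : S (fun k => (k%:R - a) ^+ 2 * pois a k + 2 * a * (k%:R * pois a k))%R =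
         S (fun k => k%:R ^+ 2 * pois a k + a ^+ 2 * pois a k)%R.
    by apply: eqS => k; ring.
  have W1 k : (0 <= k%:R * pois a k)%R by rewrite mulr_ge0.
  have W2 k : (0 <= k%:R ^+ 2 * pois a k)%R by rewrite mulr_ge0// sqr_ge0.
  have W3 k : (0 <= 2 * a * (k%:R * pois a k))%R by rewrite mulr_ge0// mulr_ge0// ltW.
  have W4 k : (0 <= a ^+ 2 * pois a k)%R by rewrite mulr_ge0// sqr_ge0.
  rewrite SD// SD// SZ// SZ//.
  rewrite M1 M2 S1 mule1 -EFinM -EFinD => E.
  have Vfin : S (fun k => (k%:R - a) ^+ 2 * pois a k)%R \is a fin_num.
    rewrite ge0_fin_numE; last by apply: nneseries_ge0 => k _ _; rewrite lee_fin.
    by move: E; case: (S _) => //= r _; rewrite ltry.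
  move: E; rewrite -(fineK Vfin) -EFinD => -[E]; congr EFin.
  by move: E; set v := fine _; lra.
have s0 : (0 < Num.sqrt a)%R by rewrite sqrtr_gt0.
have sa : (Num.sqrt a ^+ 2 = a)%R by rewrite sqr_sqrtr// ltW.
apply: (@le_trans _ _ (S (fun k => 2^-1 * (Num.sqrt a * pois a k +
    (Num.sqrt a)^-1 * ((k%:R - a) ^+ 2 * pois a k)))%R)).
  apply: leS => k; first by rewrite mulr_ge0.
  rewrite [leRHS](_ : _ = 2^-1 * (Num.sqrt a + (Num.sqrt a)^-1 *
    (k%:R - a) ^+ 2) * pois a k)%R; last by ring.
  apply: ler_wpM2r => //.
  (* AM-GM: [2 |x| s <= s^2 + x^2] *)
  rewrite -(ler_pM2l s0) -subr_ge0.
  have -> : (Num.sqrt a * (2^-1 * (Num.sqrt a + (Num.sqrt a)^-1 * (k%:R - a) ^+ 2)) -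
      Num.sqrt a * `|k%:R - a| = 2^-1 * (Num.sqrt a - `|k%:R - a|) ^+ 2)%R.
    rewrite -[in LHS](real_normK (num_real (k%:R - a)%R)).
    by field; rewrite gt_eqF.
  by rewrite mulr_ge0// sqr_ge0.
have W0 k : (0 <= (k%:R - a) ^+ 2 * pois a k)%R by rewrite mulr_ge0// sqr_ge0.
rewrite SZ => [|k]; last by rewrite addr_ge0// mulr_ge0// ?invr_ge0 ltW.
rewrite SD => [|k|k]; last 2 first.
- by rewrite mulr_ge0// ltW.
- by rewrite mulr_ge0// invr_ge0 ltW.
rewrite !SZ// S1 V mule1 -(EFinM (Num.sqrt a)^-1%R) -EFinD -EFinM lee_fin.
have -> : ((Num.sqrt a)^-1 * a = Num.sqrt a)%R.
  by rewrite -{2}sa expr2 mulKf ?gt_eqF.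
lra.
Qed.

(** Summing the recursion gives [a * y] as the sum of [k * f k]. Hence [a * (x - y)] is the sum of
    [(a - k) * f k], at most [Num.sqrt a] in absolute value since [f] is below [pois a]. *)
Lemma pois_shift_close a f g : (0 < a)%R ->
  \sum_(0 <= k <oo) (pois a k)%:E = 1 ->
  (forall k, 0 <= f k <= pois a k)%R -> (forall k, 0 <= g k)%R ->
  (forall k, k.+1%:R * f k.+1 = a * g k)%R ->
  forall x y : R, \sum_(0 <= k <oo) (f k)%:E = x%:E ->
  \sum_(0 <= k <oo) (g k)%:E = y%:E -> (`|x - y| <= (Num.sqrt a)^-1)%R.
Proof.
move=> a0 p1 fp g0 fg x y Sx Sy.
have f0 k : (0 <= f k)%R by have /andP[] := fp k.
have d0 k : (0 <= `|k%:R - a| * f k)%R by rewrite mulr_ge0.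
have mf0 k : (0 <= k%:R * f k)%R by rewrite mulr_ge0.
have Sf : S f = x%:E by exact: Sx.
have Sg : S g = y%:E by exact: Sy.
have Smf : S (fun k => k%:R * f k)%R = (a * y)%:E.
  by rewrite SS// mul0r add0e (eqS fg) SZ// Sg.
have Sd : S (fun k => `|k%:R - a| * f k)%R <= (Num.sqrt a)%:E.
  apply: le_trans (pois_deviation a0 p1); apply: leS => // k.
  by apply: ler_wpM2l => //; have /andP[] := fp k.
have Saf : S (fun k => a * f k)%R = (a * x)%:E by rewrite SZ// Sf.
have af0 k : (0 <= a * f k)%R by rewrite mulr_ge0// ltW.
have le1 : (a * y <= a * x + Num.sqrt a)%R.
  rewrite -lee_fin EFinD -Smf -Saf.
  apply: (@le_trans _ _ (S (fun k => a * f k + `|k%:R - a| * f k)%R)).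
    apply: leS => // k; rewrite -mulrDl; apply: ler_wpM2r => //.
    by rewrite addrC -lerBlDr ler_norm.
  by rewrite SD//; exact: leeD.
have le2 : (a * x <= a * y + Num.sqrt a)%R.
  rewrite -lee_fin EFinD -Smf -Saf.
  apply: (@le_trans _ _ (S (fun k => k%:R * f k + `|k%:R - a| * f k)%R)).
    apply: leS => // k; rewrite -mulrDl; apply: ler_wpM2r => //.
    by rewrite distrC addrC -lerBlDr ler_norm.
  by rewrite SD//; exact: leeD.
have s0 : (0 < Num.sqrt a)%R by rewrite sqrtr_gt0.
have sa : (Num.sqrt a ^+ 2 = a)%R by rewrite sqr_sqrtr// ltW.
rewrite -(ler_pM2l a0) -{2}sa expr2 mulfK ?gt_eqF//.
rewrite -{1}(gtr0_norm a0) -normrM ler_norml mulrBr.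
by apply/andP; split; lra.
Qed.

End poisson_deviation.

Section zero_one.
Context {R : realType} {G : transient_network R}.
Variable nu : {measure set (star G) -> \bar R}.
Variable Q : probability (configuration G) R.
Hypothesis nu_lty : forall K : {fset G}, (nu (hitting_star K) < +oo)%E.
Hypothesis nu_unbounded : forall C : R,
  exists K : {fset G}, (C%:E < nu (hitting_star K))%E.
Hypothesis Q_law : poisson_point_process nu Q.
Variable A : set (configuration G).
Hypothesis mA : measurable A.
Hypothesis A_section : forall om : configuration G,
  nu [set c | A (cfg_add om c)] = 0%E \/ nu (~` [set c | A (cfg_add om c)]) = 0%E.
Implicit Types (om : configuration G) (c : star G) (D : set (star G))
  (H : set (configuration G)).

Let fineQ H : measurable H -> Q H = (fine (Q H))%:E.
Proof. by move=> mH; rewrite fineK// fin_num_measure. Qed.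

Lemma points_partition D H : bounded_star D -> measurable H ->
  Q H = (\sum_(0 <= m <oo) Q (H `&` [set om : configuration G | om D = m%:R%:E]))%E.
Proof.
move=> bD mH; have mD : measurable D by case: bD.
rewrite -measure_semi_bigcup.
- congr (Q _); rewrite -setI_bigcupr; apply/esym/setIidl => om _.
  by have [k omk] := configuration_nat om bD; exists k.
- by move=> m; apply: measurableI => //; exact: measurable_cfg_eq.
- apply/trivIsetP => i j _ _ ij; rewrite -subset0 => om [[_ /= ->] [_ /= []]].
  by move=> /eqP; rewrite eqr_nat (negbTE ij).
- by apply: bigcupT_measurable => m; apply: measurableI => //; exact: measurable_cfg_eq.
Qed.

Lemma points_pois D m : bounded_star D ->
  Q [set om : configuration G | om D = m%:R%:E] = (pois (fine (nu D)) m)%:E.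
Proof.
move=> bD; have [Qpois _ _] := Q_law; rewrite Qpois//; first by case: bD.
exact: (bounded_star_lty nu_lty bD).
Qed.

(** The normalisation is read off [Q]: almost by definition, a configuration has some natural number
    of points in a bounded set. *)
Lemma pois_total D : bounded_star D ->
  (\sum_(0 <= m <oo) (pois (fine (nu D)) m)%:E)%E = 1%E.
Proof.
move=> bD; rewrite -(probability_setT Q) (points_partition bD)//.
by apply: eq_eseriesr => m _; rewrite setTI points_pois.
Qed.

(* [F] is the event that [A] occurs after adding a [nu]-typical trajectory. *)
Lemma section_event : exists2 F : set (configuration G), measurable F &
  forall om, (F om -> nu (~` [set c | A (cfg_add om c)]) = 0%E) /\
             (~ F om -> nu [set c | A (cfg_add om c)] = 0%E).
Proof.
(* A test set of positive and finite intensity: positivity distinguishes a null section from one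
   with null complement, finiteness makes the measure of the section measurable in [om]. *)
have [K0 K0gt0] := nu_unbounded 0.
have mK0 := @measurable_hitting_star R G K0.
pose nu0 := mfrestr mK0 (nu_lty K0).
have mX : measurable [set p : configuration G * star G | A (cfg_add p.1 p.2)].
  exact: measurable_preimage measurable_cfg_add mA.
exists [set om : configuration G |
    nu ([set c | A (cfg_add om c)] `&` hitting_star K0) != 0%E].
  have secE om : nu0 (xsection [set p | A (cfg_add p.1 p.2)] om) =
      nu ([set c | A (cfg_add om c)] `&` hitting_star K0).
    rewrite /nu0 /= /mfrestr /mrestr; congr (nu (_ `&` _)).
    by apply/seteqP; split=> c; rewrite /xsection /= inE.
  rewrite (_ : [set om | _] = (fun om => nu0
      (xsection [set p | A (cfg_add p.1 p.2)] om)) @^-1` (~` [set 0%E])).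
    exact: (measurable_preimage (measurable_fun_xsection nu0 mX)
      (measurableC (emeasurable_set1 0%E))).
  apply/seteqP; split=> om h.
    by move=> e; move/eqP: h; apply; exact: (etrans (esym (secE om)) e).
  by apply/eqP => e; apply: h; exact: (etrans (secE om) e).
move=> om; have mC := measurable_cfg_add_section om mA.
have [C0|N0] := A_section om; split=> //= hF.
- move/eqP: hF; case.
  exact: (subset_measure0 (measurableI _ _ mC mK0) mC (@subIsetl _ _ _) C0).
- move: hF => /negP; rewrite negbK => /eqP C0; move: K0gt0.
  rewrite setIC in C0.
  have D0 := subset_measure0 (measurableD mK0 mC) (measurableC mC)
    (@subIsetr _ _ _) N0.
  suff -> : nu (hitting_star K0) = 0%E by rewrite ltxx.
  apply: (etrans (measureDI nu mK0 mC)).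
  by rewrite D0 add0e; exact: C0.
Qed.

(** For fixed [om], the points [c] of [D] with [cfg_add om c] in [A] have mass [nu D] if [F om] and
    0 otherwise. So the product measure in [mecke_count] factorises. [H'] is what [H] becomes before
    a point of [D] is added. *)
Let mecke_section F : measurable F ->
  (forall om, (F om -> nu (~` [set c | A (cfg_add om c)]) = 0%E) /\
             (~ F om -> nu [set c | A (cfg_add om c)] = 0%E)) ->
  forall D m H H', bounded_star D -> measurable H -> measurable H' ->
  (forall om c, D c -> (H (cfg_add om c) <-> H' om)) ->
  (m.+1%:R%:E * Q (A `&` H `&` [set om : configuration G | om D = m.+1%:R%:E]) =
   nu D * Q (F `&` H' `&` [set om : configuration G | om D = m%:R%:E]))%E.
Proof.
move=> mF FP D m H H' bD mH mH' HH'; have mD : measurable D by case: bD.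
have Doo := bounded_star_lty nu_lty bD.
rewrite (mecke_count nu_lty Q_law mD Doo)//; last exact: measurableI.
set X := (X in product_measure1 _ _ X).
have mY : measurable (F `&` H' `&` [set om : configuration G | om D = m%:R%:E]).
  by apply: measurableI; [exact: measurableI|exact: measurable_cfg_eq].
transitivity ((Q \x mfrestr mD Doo)
    ((F `&` H' `&` [set om : configuration G | om D = m%:R%:E]) `*` setT))%E.
  rewrite /product_measure1; apply: eq_integral => om _ /=.
  rewrite /mfrestr /mrestr.
  have mC := measurable_cfg_add_section om mA.
  have [[[Fom H'om] omD]|nY] := pselect ((F `&` H' `&`
      [set om : configuration G | om D = m%:R%:E]) om).
    rewrite (_ : xsection (_ `*` _) om = setT); last first.
      by apply/seteqP; split=> c //; rewrite /xsection/= inE.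
    rewrite setTI [in RHS](measureDI nu mD mC).
    rewrite (subset_measure0 (measurableD mD mC) (measurableC mC) _ ((FP om).1 Fom));
      last by move=> c [].
    rewrite add0e; congr (nu _); apply/seteqP; split=> c;
      rewrite /xsection /X /= inE.
      by move=> [[_ [Ac _]] Dc].
    by move=> [Dc Ac]; split=> //; split=> //; split=> //; apply/HH'.
  rewrite (_ : xsection (_ `*` _) om = set0); last first.
    by rewrite -subset0 => c; rewrite /xsection/= inE => -[].
  rewrite set0I measure0.
  have [Fom|nFom] := pselect (F om).
    rewrite (_ : _ `&` _ = set0) ?measure0// -subset0 => c [].
    rewrite /xsection /X /= inE => -[omD [_ Hc]] Dc; apply: nY.
    by split=> //; split=> //; apply/(HH' om c Dc).
  have mXs : measurable (xsection X om).
    apply: measurable_xsection.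
    apply: measurableI.
      exact: (measurable_preimage measurable_fst (measurable_cfg_eq m%:R%:E mD)).
    exact: (measurable_preimage measurable_cfg_add (measurableI _ _ mA mH)).
  apply: (subset_measure0 (measurableI _ _ mXs mD) mC _ ((FP om).2 nFom)).
  by move=> c []; rewrite /xsection /X /= inE => -[_ []].
transitivity (Q (F `&` H' `&` [set om : configuration G | om D = m%:R%:E]) *
    mfrestr mD Doo setT)%E; first exact: product_measure1E.
by rewrite muleC /mfrestr /mrestr setTI.
Qed.

Let add_outside om c D : ~ D c -> cfg_add om c D = om D.
Proof. by move=> Dc; rewrite cfg_addE diracE memNset// adde0. Qed.

(** For a cylinder [H], the numbers [Q (A]&[H)] and [Q (F]&[H)] are split by the count of a set [D']
    on which [H] does not depend; [mecke_section] relates the two sequences as [pois_shift_close]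
    requires. *)
Let section_eq F : measurable F ->
  (forall om, (F om -> nu (~` [set c | A (cfg_add om c)]) = 0%E) /\
             (~ F om -> nu [set c | A (cfg_add om c)] = 0%E)) ->
  forall H, measurable H -> Q (F `&` H) = Q (A `&` H).
Proof.
move=> mF FP.
pose m1 : {measure set (configuration G) -> \bar R} := mrestr Q mF.
pose m2 : {measure set (configuration G) -> \bar R} := mrestr Q mA.
suff m12 : forall H, measurable H -> m1 H = m2 H.
  by move=> H mH; have := m12 H mH; rewrite /m1 /m2 /= /mrestr (setIC H F) (setIC H A).
apply: configuration_measure_unique.
  rewrite /m1 /= /mrestr setTI.
  by rewrite (le_lt_trans (probability_le1 _ _)) ?ltry.
move=> n D k bD; pose H := cylinder n D k.
have mH : measurable H by apply: measurable_cylinder => i; have [] := bD i.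
rewrite /m1 /m2 /= /mrestr -/H (setIC H F) (setIC H A).
have [K1 DK1] : exists K1 : {fset G}, forall i, (i < n)%N -> D i `<=` hitting_star K1.
  have /choice[Kf KfP] : forall i, exists K : {fset G}, D i `<=` hitting_star K.
    by move=> i; have [] := bD i.
  elim: n {H mH} => [|n [K1 IHn]]; first by exists fset0.
  exists (K1 `|` Kf n)%fset => i; rewrite ltnS leq_eqVlt => /predU1P[->|ni].
    by apply: subset_trans (KfP n) _; apply: hitting_starS; exact: fsubsetUr.
  by apply: subset_trans (IHn i ni) _; apply: hitting_starS; exact: fsubsetUl.
have mFH : measurable (F `&` H) by exact: measurableI.
have mAH : measurable (A `&` H) by exact: measurableI.
set x := fine (Q (A `&` H)); set y := fine (Q (F `&` H)).
suff xy : x = y by rewrite (fineQ mFH) (fineQ mAH) -/x -/y xy.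
have close (L : R) : 0 < L -> exists2 a, L < a & `|x - y| <= (Num.sqrt a)^-1.
  (* [D'] has to avoid the trajectories that [H] sees. The mass required of [K2] compensates for the
     removal of [hitting_star K1]. *)
  move=> L0; have [K2] := nu_unbounded (L + fine (nu (hitting_star K1))).
  have mK1 := @measurable_hitting_star R G K1.
  have mK2 := @measurable_hitting_star R G K2.
  pose D' := hitting_star K2 `\` (hitting_star K1 : set (star G)).
  have mD' : measurable D' by exact: measurableD.
  have bD' : bounded_star D' by split=> //; exists K2 => c [].
  have D'fin : nu D' = (fine (nu D'))%:E.
    by rewrite fineK// ge0_fin_numE// (bounded_star_lty nu_lty bD').
  move=> K2big; have La : L < fine (nu D').
    rewrite -lte_fin -D'fin.
    have K1fin : nu (hitting_star K1) \is a fin_num by rewrite ge0_fin_numE.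
    rewrite -(lteD2rE _ _ K1fin).
    rewrite -{1}(fineK K1fin) -EFinD; apply: (lt_le_trans K2big).
    apply: (le_trans _ (measureU2 _ mD' mK1)).
    apply: le_measure; rewrite ?inE//; first exact: measurableU.
    by move=> c K2c; have [K1c|nK1c] := pselect (hitting_star K1 c); [right|left].
  exists (fine (nu D')) => //; have a0 := lt_trans L0 La.
  pose f m := fine (Q (A `&` H `&` [set om : configuration G | om D' = m%:R%:E])).
  pose g m := fine (Q (F `&` H `&` [set om : configuration G | om D' = m%:R%:E])).
  have mS m := measurable_cfg_eq m%:R%:E mD'.
  apply: (@pois_shift_close _ _ f g a0 (pois_total bD')).
  - move=> m; rewrite fine_ge0//= -lee_fin -points_pois// -fineQ.
      apply: le_measure; rewrite ?inE//; first exact: measurableI.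
    exact: measurableI.
  - by move=> m; rewrite fine_ge0.
  - move=> m; apply/EFin_inj; rewrite !EFinM -D'fin /f /g.
    rewrite -!fineQ; try exact: measurableI.
    apply: mecke_section => // om c [_ nK1c].
    by split=> Hom i ni; have := Hom i ni; rewrite add_outside// => /(DK1 i ni).
  - rewrite /x -fineQ// (points_partition bD' mAH).
    by apply: eq_eseriesr => m _; rewrite -fineQ//; exact: measurableI.
  - rewrite /y -fineQ// (points_partition bD' mFH).
    by apply: eq_eseriesr => m _; rewrite -fineQ//; exact: measurableI.
apply/eqP; rewrite -subr_eq0 -normr_eq0; apply: contraT => nz.
have d0 : 0 < `|x - y| by rewrite lt_def nz normr_ge0.
(* For [a] beyond this value, the inverse square root of [a] is smaller than the distance that it
   should bound. *)
have [|a La] := close ((`|x - y| ^- 2)); first by rewrite invr_gt0 exprn_gt0.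
rewrite leNgt => /negP; case.
rewrite -[ltRHS]invrK ltf_pV2 ?posrE ?sqrtr_gt0 ?invr_gt0//; last first.
  by apply: lt_trans La; rewrite invr_gt0 exprn_gt0.
rewrite -(@ger0_norm _ (`|x - y|^-1)) ?invr_ge0// -sqrtr_sqr exprVn.
rewrite ltr_sqrt//.
by apply: lt_trans La; rewrite invr_gt0 exprn_gt0.
Qed.

(** By [section_eq], [F] can be replaced by [A] on the right of [mecke_section]: the restriction of
    [Q] to [A] satisfies the same equation as [Q]. *)
Let mecke_restricted D m H H' : bounded_star D -> measurable H -> measurable H' ->
  (forall om c, D c -> (H (cfg_add om c) <-> H' om)) ->
  (m.+1%:R%:E * Q (A `&` H `&` [set om : configuration G | om D = m.+1%:R%:E]) =
   nu D * Q (A `&` H' `&` [set om : configuration G | om D = m%:R%:E]))%E.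
Proof.
move=> bD mH mH' HH'; have [F mF FP] := section_event.
rewrite (mecke_section mF FP m bD mH mH' HH') -!setIA (section_eq mF FP)//.
by apply: measurableI => //; apply: measurable_cfg_eq; case: bD.
Qed.

(** The recursion [k.+1 * f k.+1 = a * f k] determines [f] up to a factor, so [f] is a multiple of
    [pois a]; summation over [k] identifies the factor as [Q (A]&[H)]. *)
Let restricted_pois D m H : bounded_star D -> measurable H ->
  (forall om c, D c -> (H (cfg_add om c) <-> H om)) ->
  Q (A `&` H `&` [set om : configuration G | om D = m%:R%:E]) =
  (Q (A `&` H) * (pois (fine (nu D)) m)%:E)%E.
Proof.
move=> bD mH HD; have mD : measurable D by case: bD.
have mAH : measurable (A `&` H) by exact: measurableI.
have mS k := measurable_cfg_eq k%:R%:E mD.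
have mAHS k := measurableI _ _ mAH (mS k).
pose f k := fine (Q (A `&` H `&` [set om : configuration G | om D = k%:R%:E])).
set a := fine (nu D).
have Dfin : nu D = a%:E by rewrite fineK// ge0_fin_numE// (bounded_star_lty nu_lty bD).
have fS k : k.+1%:R * f k.+1 = a * f k.
  apply/EFin_inj; rewrite !EFinM -Dfin /f -!fineQ//.
  exact: mecke_restricted.
have fE k : f k = f 0%N * expR a * pois a k.
  elim: k => [|k IHk].
    by rewrite /pois expr0 fact0 divr1 mul1r -mulrA -expRD subrr expR0 mulr1.
  apply: (@mulfI _ (k.+1%:R : R)); first by rewrite pnatr_eq0.
  by rewrite fS IHk mulrCA -poisS mulrCA.
have f00 : 0 <= f 0%N by rewrite fine_ge0.
have : Q (A `&` H) = (f 0%N * expR a)%:E.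
  rewrite (points_partition bD mAH).
  transitivity (\sum_(0 <= k <oo) ((f 0%N * expR a)%:E * (pois a k)%:E))%E.
    by apply: eq_eseriesr => k _; rewrite -EFinM -fE /f -fineQ.
  rewrite nneseriesZl ?pois_total ?mule1// => k _.
  by rewrite lee_fin pois_ge0// fine_ge0.
by move=> ->; rewrite -EFinM -fE /f -fineQ.
Qed.

(** The cells are adjoined one at a time: by disjointness, a point added in the new cell leaves the
    earlier counts unchanged, as [restricted_pois] requires. *)
Let restricted_cells n (E : 'I_n -> set (star G)) (k : 'I_n -> nat) :
  (forall i, bounded_star (E i)) -> trivIset setT E -> forall s : seq 'I_n, uniq s ->
  Q (A `&` [set om : configuration G | forall i, i \in s -> om (E i) = (k i)%:R%:E]) =
  (Q A * (\prod_(i <- s) pois (fine (nu (E i))) (k i))%:E)%E.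
Proof.
move=> bE tE; elim=> [_|j s IHs /= /andP[js us]].
  by rewrite big_nil mule1; congr (Q _); apply/setIidl.
pose H := [set om : configuration G | forall i, i \in s -> om (E i) = (k i)%:R%:E].
rewrite (_ : A `&` _ =
    A `&` H `&` [set om : configuration G | om (E j) = (k j)%:R%:E]); last first.
  rewrite -setIA; congr (_ `&` _); apply/seteqP; split=> om /=.
    by move=> Hom; split=> [i si|]; apply: Hom; rewrite inE ?si ?orbT ?eqxx.
  by move=> [Hom Hj] i; rewrite inE => /predU1P[->|/Hom].
rewrite restricted_pois//.
- by rewrite IHs// -muleA -EFinM big_cons mulrC.
- rewrite (_ : H = \bigcap_(i in [set` s])
      [set om : configuration G | om (E i) = (k i)%:R%:E]); last by [].
  apply: fin_bigcap_measurable => [|i _]; first exact: finite_seq.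
  by apply: measurable_cfg_eq; case: (bE i).
- move=> om c Ejc; have outE i : i \in s -> cfg_add om c (E i) = om (E i).
    move=> si; apply: add_outside => Eic; have ij : i != j.
      by apply: contraNneq js => <-.
    move/trivIsetP : tE => /(_ i j Logic.I Logic.I ij).
    by rewrite -subset0 => /(_ c); apply.
  by split=> Hom i si; have := Hom i si; rewrite outE.
Qed.

(** The restriction of [Q] to [A] and [Q A] times [Q] agree on the counts of disjoint cells, hence
    on all events. Evaluated at [A] itself, this reads [q = q * q]. *)
Theorem poisson_zero_one : Q A = 0%E \/ Q A = 1%E.
Proof.
have b0 : bounded_star (set0 : set (star G)) by split=> //; exists fset0.
pose m1 : {measure set (configuration G) -> \bar R} := mrestr Q mA.
pose m2 : {measure set (configuration G) -> \bar R} :=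
  mscale (NngNum (fine_ge0 (measure_ge0 Q A))) Q.
have : m1 A = m2 A.
  apply: (configuration_measure_unique_disjoint b0) mA.
    rewrite /m1 /= /mrestr setTI.
    by rewrite (le_lt_trans (probability_le1 _ _)) ?ltry.
  move=> n E J k bE tE _ H; rewrite /m1 /m2 /= /mscale /= /mrestr setIC.
  have := @restricted_cells n E k bE tE (index_enum 'I_n) (index_enum_uniq _).
  rewrite -(poisson_disjoint nu_lty Q_law _ bE tE) -fineQ// => <-.
  congr (Q (_ `&` _)); apply/seteqP; split=> om Hom i //.
  by apply: Hom; rewrite mem_index_enum.
rewrite /m1 /m2 /= /mscale /= /mrestr setIid (fineQ mA) -EFinM => -[].
set q := fine _ => /esym/eqP; rewrite -subr_eq0 -{3}[q]mulr1 -mulrBr mulf_eq0.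
by rewrite subr_eq0 => /orP[/eqP ->|/eqP ->]; [left|right].
Qed.

End zero_one.

Theorem theorem5 (R : realType) (G : transient_network R)
    (P : G -> probability (semi_trajectory G) R)
    (nuK : {fset G} -> {measure set (trajectory G) -> \bar R})
    (nu : {measure set (star G) -> \bar R})
    (Q : probability (configuration G) R)
    (P_law : markov_chain_law P)
    (nuK_law : forall K : {fset G}, two_sided_law P K (nuK K))
    (nu_law : interlacement_intensity nuK nu)
    (Q_law : poisson_point_process nu Q)
    (P_tail : tail_trivial P) :
  forall A : set (configuration G), non_local_events A ->
    Q A = 0%E \/ Q A = 1%E.
Proof.
move=> A nlA; have mA := measurable_non_local nlA.
apply: (@poisson_zero_one R G nu Q) => //.
- exact: intensity_hitting_lty nuK_law nu_law.
- exact: intensity_hitting_unbounded P_law nuK_law nu_law.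
- move=> om; apply: (intensity_zero_one P_law nuK_law nu_law P_tail).
    exact: measurable_cfg_add_section.
  by move=> K; exact: non_local_section.
Qed.
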